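(* For a finite $RG$-module $A$, the following two statements are equivalent: (i) $A$ is cohomologically trivial (CT). (ii) For all exact sequences $0\to M\to L\to A\to 0$ of $RG$-modules with $L$ free of finite rank, we have $r_R(M)=r_R(L)$.
   Context: $p$ is a prime, $G$ is a finite $p$-group, and $R$ is the ring of integers of a finite extension $K$ of $\mathbb{Q}_p$, with uniformizing element $\pi$ and residue field $\overline{K}=R/(\pi)$. For a finitely generated $RG$-module $A$, $r_R(A)=\dim_{\overline{K}} A/(\pi A+[A,G])$, where $[A,G]=\mathfrak{I}A$ and $\mathfrak{I}$ is the augmentation ideal of $RG$. A $G$-module $A$ is called cohomologically trivial (CT) if the Tate cohomology groups $\hat{H}^n(S,A)$ are zero for all subgroups $S\leq G$ and all integers $n$. *)

(* Defs.v *)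
From HB Require Import structures.
From mathcomp Require Import all_boot all_order all_fingroup all_algebra.
From mathcomp Require Import all_solvable all_field.
From mathcomp Require Import generic_quotient ring_quotient.
From mathcomp Require Import boolp classical_sets.

Set Implicit Arguments.
Unset Strict Implicit.
Unset Printing Implicit Defensive.

Import Order.TTheory GRing.Theory Num.Theory.

Local Open Scope ring_scope.

(* The field Q_p, as a completion of Q for the p-adic absolute value: a        *)
(* complete valued field in which Q, with |n| = p ^ - v_p(n), is dense. The    *)
(* absolute value of Q_p only takes the values 0 and p ^ k, hence rat.         *)
Record padicField (p : nat) := PadicField {
  padic_sort :> fieldType;
  padic_norm : padic_sort -> rat;
  padic_norm_ge0 : forall x, 0 <= padic_norm x;
  padic_norm_eq0 : forall x, padic_norm x = 0 <-> x = 0;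
  padic_normM : forall x y,
    padic_norm (x * y) = padic_norm x * padic_norm y;
  padic_normD : forall x y,
    padic_norm (x + y) <= Num.max (padic_norm x) (padic_norm y);
  padic_norm_nat : forall n : nat, (0 < n)%N ->
    padic_norm n%:R = p%:R ^- logn p n;
  padic_dense : forall (x : padic_sort) (e : rat), 0 < e ->
    exists q : rat, padic_norm (x - ratr q) < e;
  padic_complete : forall u : nat -> padic_sort,
    (forall e : rat, 0 < e -> exists N, forall m n,
       (N <= m)%N -> (N <= n)%N -> padic_norm (u m - u n) < e) ->
    exists l, forall e : rat, 0 < e -> exists N, forall n,
       (N <= n)%N -> padic_norm (u n - l) < e
}.

Section PadicIntegers.
Variables (p : nat) (Qp : padicField p).

Definition padic_int_pred : {pred Qp} := fun x => padic_norm x <= 1.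

Lemma padic_norm1 : padic_norm (1 : Qp) = 1.
Proof. by rewrite -[1]/(1%:R) padic_norm_nat // logn1 expr0 invr1. Qed.

Lemma padic_normN1 : padic_norm (- 1 : Qp) = 1.
Proof.
have: padic_norm (- 1 : Qp) ^+ 2 = 1.
  by rewrite expr2 -padic_normM mulrNN mulr1 padic_norm1.
by move/eqP; rewrite sqrp_eq1 ?padic_norm_ge0 // => /eqP.
Qed.

Lemma padic_int_subring : subring_closed padic_int_pred.
Proof.
split=> [|x y|x y]; rewrite /in_mem /= /padic_int_pred.
- by rewrite padic_norm1.
- move=> hx hy; apply: le_trans (padic_normD _ _) _.
  by rewrite ge_max hx -mulN1r padic_normM padic_normN1 mul1r.
- by move=> hx hy; rewrite padic_normM mulr_ile1 ?padic_norm_ge0.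
Qed.

HB.instance Definition _ :=
  GRing.isSubringClosed.Build Qp padic_int_pred padic_int_subring.

Record padic_int := PadicInt { padic_val : Qp; _ : padic_val \in padic_int_pred }.

HB.instance Definition _ := [isSub for padic_val].
HB.instance Definition _ := [Choice of padic_int by <:].
HB.instance Definition _ := [SubChoice_isSubComNzRing of padic_int by <:].

End PadicIntegers.

(* The ring of integers of a finite extension K of Q_p: the integral closure   *)
(* of Z_p in K.                                                                *)
Section RingOfIntegers.
Variables (p : nat) (Qp : padicField p) (K : fieldExtType Qp).

Definition padic_int_in (z : padic_int Qp) : K := in_alg K (val z).

Fact padic_int_in_zmod : zmod_morphism padic_int_in.
Proof. by move=> x y; rewrite /padic_int_in !rmorphB. Qed.
Fact padic_int_in_monoid : monoid_morphism padic_int_in.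
Proof. by split=> [|x y]; rewrite /padic_int_in ?rmorph1 ?rmorphM. Qed.
HB.instance Definition _ :=
  GRing.isZmodMorphism.Build (padic_int Qp) K padic_int_in padic_int_in_zmod.
HB.instance Definition _ :=
  GRing.isMonoidMorphism.Build (padic_int Qp) K padic_int_in padic_int_in_monoid.

Definition integer_pred : {pred K} := fun x => `[< integralOver padic_int_in x >].

Lemma integer_subring : subring_closed integer_pred.
Proof.
split=> [|x y|x y]; rewrite /in_mem /= /integer_pred.
- by apply/asboolP; exact: integral1.
- by move=> /asboolP hx /asboolP hy; apply/asboolP; exact: integral_sub.
- by move=> /asboolP hx /asboolP hy; apply/asboolP; exact: integral_mul.
Qed.

HB.instance Definition _ :=
  GRing.isSubringClosed.Build K integer_pred integer_subring.

Record ringOfIntegers :=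
  RingOfIntegers { integer_val : K; _ : integer_val \in integer_pred }.

HB.instance Definition _ := [isSub for integer_val].
HB.instance Definition _ := [Choice of ringOfIntegers by <:].
HB.instance Definition _ := [SubChoice_isSubComNzRing of ringOfIntegers by <:].

End RingOfIntegers.

(* A generator of the maximal ideal of a local ring: its multiples are exactly *)
(* the non-units.                                                              *)
Record uniformizer (R : comNzRingType) := Uniformizer {
  unif : R;
  unifP : forall x : R,
    (exists y, x = unif * y) <-> ~ (exists y, x * y = 1)
}.

Section ResidueField.
Variables (R : comNzRingType) (pi : uniformizer R).

Definition unif_ideal : {pred R} := fun x => `[< exists y, x = unif pi * y >].

Lemma unif_ideal_closed : idealr_closed unif_ideal.
Proof.
split; rewrite /in_mem /= /unif_ideal.
- by apply/asboolP; exists 0; rewrite mulr0.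
- by apply/asboolP => /unifP; apply; exists 1; rewrite mulr1.
- move=> a x y /asboolP [x' ->] /asboolP [y' ->].
  by apply/asboolP; exists (a * x' + y'); rewrite mulrDr mulrCA.
Qed.

HB.instance Definition _ := isIdealr.Build R unif_ideal unif_ideal_closed.

Definition residueField : Type := {ideal_quot unif_ideal}.
HB.instance Definition _ := GRing.ComNzRing.on residueField.

Definition residue (r : R) : residueField := \pi_({ideal_quot unif_ideal})%qT r.
Definition residue_lift (c : residueField) : R :=
  repr (c : {ideal_quot unif_ideal}).

Lemma residue_liftK : cancel residue_lift residue.
Proof. by move=> c; rewrite /residue /residue_lift reprK. Qed.

Lemma residue_eq r s : residue r = residue s <-> exists t, r - s = unif pi * t.
Proof.
have E : (residue r == residue s) = (r - s \in unif_ideal).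
  by rewrite Quotient.idealrBE.
split=> [/eqP | h]; first by rewrite E => /asboolP.
by apply/eqP; rewrite E; apply/asboolP.
Qed.

Lemma residue1 : residue 1 = 1.
Proof. by rewrite /residue rmorph1. Qed.
Lemma residueD r s : residue (r + s) = residue r + residue s.
Proof. by rewrite /residue rmorphD. Qed.
Lemma residueM r s : residue (r * s) = residue r * residue s.
Proof. by rewrite /residue rmorphM. Qed.
Lemma residue0 : residue 0 = 0.
Proof. by rewrite /residue rmorph0. Qed.

Lemma residue_inv_exists (c : residueField) :
  exists d, (c != 0 -> d * c = 1) /\ (c = 0 -> d = 0).
Proof.
case: (eqVneq c 0) => [_|c0]; first by exists 0.
suff [y hy] : exists y, residue_lift c * y = 1.
  exists (residue y); split=> [_|/eqP]; last by rewrite (negPf c0).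
  by rewrite -{1}(residue_liftK c) mulrC -residueM hy residue1.
apply: contrapT => /(unifP pi) [y hy]; case/eqP: c0.
rewrite -(residue_liftK c) -residue0; apply/residue_eq.
by exists y; rewrite subr0.
Qed.

Definition residue_inv (c : residueField) : residueField :=
  projT1 (cid (residue_inv_exists c)).

Fact residue_mulVf (c : residueField) : c != 0 -> residue_inv c * c = 1.
Proof. by rewrite /residue_inv; case: cid => d /= [h _]. Qed.

Fact residue_invr0 : residue_inv 0 = 0.
Proof. by rewrite /residue_inv; case: cid => d /= [_ ->]. Qed.

HB.instance Definition _ :=
  GRing.ComNzRing_isField.Build residueField residue_mulVf residue_invr0.

End ResidueField.

(* The group ring RG, with the convolution product.                            *)
Section GroupRing.
Variables (R : comNzRingType) (gT : finGroupType).

Definition groupRing : Type := {ffun gT -> R}.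
HB.instance Definition _ := GRing.Zmodule.on groupRing.

Implicit Types u v w : groupRing.

Definition gr_fun (u : groupRing) : gT -> R := fun_of_fin (u : {ffun gT -> R}).
Arguments gr_fun : simpl never.
Local Coercion gr_fun : groupRing >-> Funclass.

Definition gr_const (r : R) : groupRing := [ffun g => r *+ (g == 1%g)].
Definition gr_delta (g : gT) : groupRing := [ffun h => (h == g)%:R].
Definition gr_mul u v : groupRing := [ffun x => \sum_y u y * v (y^-1 * x)%g].

Lemma gr_mulE u v x : gr_mul u v x = \sum_y u y * v (y^-1 * x)%g.
Proof. by rewrite /gr_fun ffunE. Qed.
Lemma gr_addE u v x : gr_fun (u + v) x = gr_fun u x + gr_fun v x.
Proof. by rewrite /gr_fun ffunE. Qed.
Lemma gr_constE r x : gr_const r x = r *+ (x == 1%g).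
Proof. by rewrite /gr_fun ffunE. Qed.
Lemma gr_deltaE g x : gr_delta g x = (x == g)%:R.
Proof. by rewrite /gr_fun ffunE. Qed.
Lemma gr_ext u v : u =1 v -> u = v.
Proof. by move=> h; apply/ffunP => x; exact: h. Qed.

Lemma gr_const_mulE r u x : gr_mul (gr_const r) u x = r * u x.
Proof.
rewrite gr_mulE (bigD1 1%g) //= gr_constE eqxx mulr1n invg1 mul1g.
by rewrite big1 ?addr0 // => y /negPf y1; rewrite gr_constE y1 mul0r.
Qed.

Lemma gr_mul_constE r u x : gr_mul u (gr_const r) x = u x * r.
Proof.
rewrite gr_mulE (bigD1 x) //= gr_constE mulVg eqxx mulr1n.
rewrite big1 ?addr0 // => y /negPf yx.
by rewrite gr_constE -eq_mulVg1 yx mulr0.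
Qed.

Fact gr_mulA : associative gr_mul.
Proof.
move=> u v w; apply: gr_ext => x; rewrite !gr_mulE.
under eq_bigr do rewrite gr_mulE big_distrr /=.
under [RHS]eq_bigr do rewrite gr_mulE big_distrl /=.
rewrite [RHS]exchange_big /=; apply: eq_bigr => y _.
rewrite [RHS](reindex_inj (mulgI y)) /=; apply: eq_bigr => z _.
by rewrite mulKg invMg mulgA mulrA.
Qed.

Fact gr_mul1 : left_id (gr_const 1) gr_mul.
Proof. by move=> u; apply: gr_ext => x; rewrite gr_const_mulE mul1r. Qed.
Fact gr_mulr1 : right_id (gr_const 1) gr_mul.
Proof. by move=> u; apply: gr_ext => x; rewrite gr_mul_constE mulr1. Qed.
Fact gr_mulDl : left_distributive gr_mul +%R.
Proof.
move=> u v w; apply: gr_ext => x; rewrite gr_addE !gr_mulE -big_split /=.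
by apply: eq_bigr => y _; rewrite gr_addE mulrDl.
Qed.
Fact gr_mulDr : right_distributive gr_mul +%R.
Proof.
move=> u v w; apply: gr_ext => x; rewrite gr_addE !gr_mulE -big_split /=.
by apply: eq_bigr => y _; rewrite gr_addE mulrDr.
Qed.
Fact gr_one_neq0 : gr_const 1 != 0.
Proof.
apply/eqP => /(congr1 (fun u : groupRing => u 1%g)).
rewrite gr_constE eqxx /gr_fun ffunE => /eqP.
by rewrite oner_eq0.
Qed.

HB.instance Definition _ := GRing.Zmodule_isNzRing.Build groupRing
  gr_mulA gr_mul1 gr_mulr1 gr_mulDl gr_mulDr gr_one_neq0.

Definition augmentation (u : groupRing) : R := \sum_g u g.

Lemma augmentation_constM r u : augmentation (gr_const r * u) = r * augmentation u.
Proof.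
rewrite /augmentation big_distrr /=.
by apply: eq_bigr => x _; exact: gr_const_mulE.
Qed.

Lemma gr_constC r u : gr_const r * u = u * gr_const r.
Proof.
by apply: gr_ext => x; rewrite [LHS]gr_const_mulE [RHS]gr_mul_constE mulrC.
Qed.
Lemma gr_constD r s : gr_const (r + s) = gr_const r + gr_const s.
Proof. by apply: gr_ext => x; rewrite gr_addE !gr_constE mulrnDl. Qed.
Lemma gr_constM r s : gr_const (r * s) = gr_const r * gr_const s.
Proof.
by apply: gr_ext => x; rewrite [RHS]gr_const_mulE !gr_constE mulrnAr.
Qed.

End GroupRing.

Section TopQuotient.
Variables (R : comNzRingType) (pi : uniformizer R) (gT : finGroupType).
Local Notation RG := (groupRing R gT).
Variable A : lmodType RG.

(* [A, G] = I A, where I is the augmentation ideal of RG. *)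
Definition augmentation_submod (a : A) : Prop :=
  exists n (u : 'I_n -> RG) (b : 'I_n -> A),
    (forall i, augmentation (u i) = 0) /\ a = \sum_i u i *: b i.

(* pi A + [A, G] *)
Definition top_submod : {pred A} := fun a =>
  `[< exists b c, augmentation_submod c /\ a = gr_const gT (unif pi) *: b + c >].

Lemma augmentation_submod0 : augmentation_submod 0.
Proof.
exists 0, (fun=> 0), (fun=> 0); split; first by case.
by rewrite big_ord0.
Qed.

Lemma augmentation_submodD a b : augmentation_submod a ->
  augmentation_submod b -> augmentation_submod (a + b).
Proof.
move=> [m [u [c [hu ->]]]] [n [v [d [hv ->]]]].
exists (m + n)%N,
  (fun i => match split i with inl j => u j | inr j => v j end),
  (fun i => match split i with inl j => c j | inr j => d j end).
split=> [i|]; first by case: (split i).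
rewrite big_split_ord /=; congr (_ + _); apply: eq_bigr => i _.
  by rewrite (unsplitK (inl i)).
by rewrite (unsplitK (inr i)).
Qed.

Lemma augmentation_submod_const r a : augmentation_submod a ->
  augmentation_submod (gr_const gT r *: a).
Proof.
move=> [m [u [c [hu ->]]]]; exists m, (fun i => gr_const gT r * u i), c.
split=> [i|]; first by rewrite augmentation_constM hu mulr0.
by rewrite scaler_sumr; apply: eq_bigr => i _; rewrite scalerA.
Qed.

Lemma top_submod_const r a : a \in top_submod ->
  gr_const gT r *: a \in top_submod.
Proof.
move=> /asboolP [b [c [hc ->]]]; apply/asboolP.
exists (gr_const gT r *: b), (gr_const gT r *: c).
split; first exact: augmentation_submod_const.
by rewrite scalerDr !scalerA gr_constC.
Qed.

Lemma top_submod_pi a : gr_const gT (unif pi) *: a \in top_submod.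
Proof.
by apply/asboolP; exists a, 0; rewrite addr0; split=> //; exact: augmentation_submod0.
Qed.

Lemma top_submod_closed : zmod_closed top_submod.
Proof.
have D a b : a \in top_submod -> b \in top_submod -> a + b \in top_submod.
  move=> /asboolP [a1 [a2 [ha ->]]] /asboolP [b1 [b2 [hb ->]]]; apply/asboolP.
  exists (a1 + b1), (a2 + b2); split; first exact: augmentation_submodD.
  by rewrite scalerDr addrACA.
split=> [|a b ha hb].
  by have := top_submod_pi 0; rewrite scaler0.
apply: D => //; have := top_submod_const (- 1) hb.
suff -> : gr_const gT (- 1 : R) = - 1 by rewrite scaleN1r.
by apply: gr_ext => x; rewrite gr_constE /gr_fun !ffunE mulNrn.
Qed.

HB.instance Definition _ := GRing.isZmodClosed.Build A top_submod top_submod_closed.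

(* A / (pi A + [A, G]), as a vector space over the residue field *)
Definition topQuotient : Type := Quotient.quot top_submod.
HB.instance Definition _ := GRing.Zmodule.on topQuotient.

Definition top_class (a : A) : topQuotient := \pi_(Quotient.quot top_submod)%qT a.
Definition top_lift (x : topQuotient) : A := repr (x : Quotient.quot top_submod).

Lemma top_liftK : cancel top_lift top_class.
Proof. by move=> x; rewrite /top_class /top_lift reprK. Qed.

Lemma top_classD a b : top_class (a + b) = top_class a + top_class b.
Proof. by rewrite /top_class raddfD. Qed.

Lemma top_class_eq a b : top_class a = top_class b <-> a - b \in top_submod.
Proof.
have E : (top_class a == top_class b) = (a - b \in top_submod).
  by rewrite Quotient.idealrBE.
by split=> [/eqP | h]; [rewrite E | apply/eqP; rewrite E].
Qed.

Definition top_scale (c : residueField pi) (x : topQuotient) : topQuotient :=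
  top_class (gr_const gT (residue_lift c) *: top_lift x).

Lemma top_scaleE r a :
  top_scale (residue pi r) (top_class a) = top_class (gr_const gT r *: a).
Proof.
have [s hs] : exists s, residue_lift (residue pi r) - r = unif pi * s.
  by apply/residue_eq; rewrite residue_liftK.
have ha : top_lift (top_class a) - a \in top_submod.
  by apply/top_class_eq; rewrite top_liftK.
rewrite /top_scale; apply/top_class_eq.
set r' := residue_lift _ in hs *; set a' := top_lift _ in ha *.
have -> : r' = unif pi * s + r by rewrite -hs subrK.
rewrite gr_constD gr_constM scalerDl -addrA -scalerBr -scalerA.
by apply: rpredD; [exact: top_submod_pi | exact: top_submod_const].
Qed.

Fact top_scaleA b c x : top_scale b (top_scale c x) = top_scale (b * c) x.
Proof.
rewrite -(residue_liftK b) -(residue_liftK c) -(top_liftK x) -residueM.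
by rewrite !top_scaleE gr_constM scalerA.
Qed.
Fact top_scale1 : left_id 1 top_scale.
Proof.
by move=> x; rewrite -residue1 -(top_liftK x) top_scaleE scale1r.
Qed.
Fact top_scaleDr : right_distributive top_scale +%R.
Proof.
move=> c x y; rewrite -(residue_liftK c) -(top_liftK x) -(top_liftK y).
by rewrite -top_classD !top_scaleE scalerDr top_classD.
Qed.
Fact top_scaleDl x : {morph top_scale^~ x : b c / b + c}.
Proof.
move=> b c; rewrite -(residue_liftK b) -(residue_liftK c) -(top_liftK x).
by rewrite -residueD !top_scaleE gr_constD scalerDl top_classD.
Qed.

HB.instance Definition _ := GRing.Zmodule_isLmodule.Build (residueField pi)
  topQuotient top_scaleA top_scale1 top_scaleDr top_scaleDl.

End TopQuotient.

Definition has_dimension (F : fieldType) (V : lmodType F) (n : nat) : Prop :=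
  exists f : {linear V -> 'rV[F]_n}, bijective f.

(* The default value 0 is returned for an infinite-dimensional V. *)
Definition dimension (F : fieldType) (V : lmodType F) : nat :=
  xget 0%N [set n | has_dimension V n]%classic.

Definition rR (R : comNzRingType) (pi : uniformizer R) (gT : finGroupType)
    (A : lmodType (groupRing R gT)) : nat :=
  dimension (topQuotient pi A).

(* Tate cohomology of a finite group H acting on A, by the complete standard   *)
(* resolution: for n >= 0, X^n and X^(-n-1) are both the group of functions    *)
(* f : H^(n+1) -> A, on which H acts by (h f)(x) = h f(h^-1 x), and the Tate   *)
(* cohomology groups are those of the complex of invariants                    *)
(*     ... -> X^-2 -> X^-1 -> X^0 -> X^1 -> ...                                *)
(* whose differentials are tate_cobound from X^n to X^(n+1), tate_bound from   *)
(* X^(-n-2) to X^(-n-1), and tate_norm from X^-1 to X^0.                       *)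
Section Tate.
Variables (H : finGroupType) (A : zmodType) (act : H -> A -> A).

Definition tate_cochain (n : nat) : Type := n.+1.-tuple H -> A.

Definition tate_invariant n (f : tate_cochain n) : Prop :=
  forall h x, f [tuple (h * tnth x i)%g | i < n.+1] = act h (f x).

Definition tate_cobound n (f : tate_cochain n) : tate_cochain n.+1 := fun x =>
  \sum_(i < n.+2) f [tuple tnth x (lift i j) | j < n.+1] *~ (-1) ^+ i.

Definition tate_norm (f : tate_cochain 0) : tate_cochain 0 := fun=>
  \sum_(h : H) f [tuple h].

Definition tuple_insert n (i : 'I_n.+2) (h : H) (x : n.+1.-tuple H) :
    n.+2.-tuple H :=
  [tuple if unlift i j is Some k then tnth x k else h | j < n.+2].

Definition tate_bound n (f : tate_cochain n.+1) : tate_cochain n := fun x =>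
  \sum_(i < n.+2) (\sum_(h : H) f (tuple_insert i h x)) *~ (-1) ^+ i.

Definition tate_exact l m n (d : tate_cochain l -> tate_cochain m)
    (d' : tate_cochain m -> tate_cochain n) : Prop :=
  forall f, tate_invariant f -> d' f =1 (fun=> 0) ->
  exists g, tate_invariant g /\ f =1 d g.

(* The n-th Tate cohomology group of H with coefficients in A is zero. *)
Definition tate_vanishes (n : int) : Prop :=
  match n with
  | Posz 0 => tate_exact tate_norm (@tate_cobound 0)
  | Posz m.+1 => tate_exact (@tate_cobound m) (@tate_cobound m.+1)
  | Negz 0 => tate_exact (@tate_bound 0) tate_norm
  | Negz m.+1 => tate_exact (@tate_bound m.+1) (@tate_bound m)
  end.

End Tate.

Definition cohomologically_trivial (R : comNzRingType) (gT : finGroupType)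
    (A : lmodType (groupRing R gT)) : Prop :=
  forall (S : {group gT}) (n : int),
    tate_vanishes (fun (s : subg_of S) (a : A) => gr_delta R (sgval s) *: a) n.

Definition short_exact (S : nzRingType) (M L A : lmodType S)
    (i : {linear M -> L}) (q : {linear L -> A}) : Prop :=
  [/\ injective i, (forall a, exists x, q x = a)
    & forall x, q x = 0 <-> exists m, x = i m].

Definition free_of_finite_rank (S : nzRingType) (L : lmodType S) : Prop :=
  exists n (f : {linear 'rV[S]_n -> L}), bijective f.

(* Main.v *)
Require Import Defs.
From HB Require Import structures.
From mathcomp Require Import all_boot all_order all_fingroup all_algebra.
From mathcomp Require Import all_solvable all_field.
From mathcomp Require Import boolp.
From mathcomp Require classical_sets.

(* Write nu for the sum of the elements of G. The kernel M of an epimorphism   *)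
(* from a free module L onto the finite module A contains a multiple pi^m L,   *)
(* so M is R-free of the same R-rank as L. If A is cohomologically trivial,    *)
(* then so is M by the long exact sequence, and the vanishing of the Tate      *)
(* groups in degrees -1 and 0 shows that nu x in pi M forces x in              *)
(* pi M + [M, G]. Lift a basis of M / (pi M + [M, G]) to x_1, ..., x_r: since  *)
(* every nonzero submodule of a power of kG contains a nonzero multiple of nu  *)
(* (G being a p-group), the g x_j are independent modulo pi; by Nakayama they  *)
(* also span M, so counting R-ranks gives r = r(L). Conversely, if r(M) = r(L) *)
(* for one such presentation, then Nakayama gives r(L) generators of M, whose  *)
(* translates are as many as the R-rank of M, hence form an R-basis: M is free *)
(* over RG, and A is a quotient of free modules with free kernel.              *)

Set Implicit Arguments.
Unset Strict Implicit.
Unset Printing Implicit Defensive.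

Import Order.TTheory GRing.Theory Num.Theory.

Local Open Scope ring_scope.

(** The argument compares ranks over [R]. A power of the uniformizer kills the finite module [A]
    ([finite_unif_torsion]), so [M] lies between [pi^m L] and [L] and is [R]-free of the same rank,
    namely |G| n when [L] has [RG]-rank n ([submodule_basis], from [echelon_basis]). A lifted basis
    of M / (pi M + [M, G]) always generates [M] over [RG]: this is Nakayama's lemma, once for the
    local ring [R] ([nakayama]) and once for the p-group ([pgroup_nakayama]). If r(M) = n, its |G| n
    translates span a free [R]-module of rank |G| n, hence form a basis ([spanning_basis]), and [M]
    is [RG]-free ([group_ring_basis_of_rR]).

    Cohomology enters twice. Free modules are CT ([translates_cohomologically_trivial]), so the long
    exact sequence makes [A] CT exactly when [M] is ([tate_sub], [tate_quotient]). And an [R]-free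
    CT module of [R]-rank |G| n satisfies r = n ([rR_eq_of_norm]): by [norm_top_of_tate], norms
    divisible by pi come only from pi M + [M, G], while [pgroup_fixed] turns any dependence modulo
    pi among the translates into one whose coefficients are multiples of the norm element modulo pi.
    This is applied to [L] as well as to [M]. *)

(** * Cochain operators given by integer kernels *)

Section IntegerKernels.
Variable H : finGroupType.
Implicit Types (l m n : nat) (A B : zmodType).

Definition shift n (h : H) (x : n.+1.-tuple H) : n.+1.-tuple H :=
  [tuple (h * tnth x i)%g | i < n.+1].

Lemma shift1 n (x : n.+1.-tuple H) : shift 1 x = x.
Proof. by apply: eq_from_tnth => i; rewrite tnth_mktuple mul1g. Qed.

Lemma shiftM n g h (x : n.+1.-tuple H) : shift (g * h) x = shift g (shift h x).
Proof. by apply: eq_from_tnth => i; rewrite !tnth_mktuple mulgA. Qed.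

Lemma shiftK n h : cancel (@shift n h) (shift h^-1).
Proof. by move=> x; rewrite -shiftM mulVg shift1. Qed.

Lemma shiftVK n h : cancel (@shift n h^-1) (shift h).
Proof. by move=> x; rewrite -shiftM mulgV shift1. Qed.

(* All the differentials of the Tate complex are given by integer kernels,     *)
(* which makes them natural in the coefficients and, when the kernel is        *)
(* shift-invariant, equivariant.                                               *)
Definition kernel m n := m.+1.-tuple H -> n.+1.-tuple H -> int.

Definition kop A m n (D : kernel m n) (f : tate_cochain H A m) :
  tate_cochain H A n := fun x => \sum_y f y *~ D y x.

Definition kcomp l m n (D : kernel l m) (E : kernel m n) : kernel l n :=
  fun z x => \sum_y D z y * E y x.

Definition shift_invariant m n (D : kernel m n) :=
  forall h y x, D (shift h y) (shift h x) = D y x.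

Lemma kop_eq A m n (D : kernel m n) (f g : tate_cochain H A m) :
  f =1 g -> kop D f =1 kop D g.
Proof. by move=> fg x; apply: eq_bigr => y _; rewrite fg. Qed.

Lemma kop_nat A B (phi : {additive A -> B}) m n (D : kernel m n) f x :
  kop D (phi \o f) x = phi (kop D f x).
Proof. by rewrite raddf_sum; apply: eq_bigr => y _ /=; rewrite raddfMz. Qed.

Lemma kopB A m n (D : kernel m n) (f g : tate_cochain H A m) x :
  kop D (fun y => f y - g y) x = kop D f x - kop D g x.
Proof. by rewrite -sumrB; apply: eq_bigr => y _; rewrite mulrzBl. Qed.

Lemma kop_sum A m n (D : kernel m n) (I : finType)
    (f : I -> tate_cochain H A m) x :
  kop D (fun y => \sum_i f i y) x = \sum_i kop D (f i) x.
Proof.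
by rewrite exchange_big; apply: eq_bigr => y _; rewrite /= mulrz_suml.
Qed.

Lemma kop_shift A m n (D : kernel m n) (f : tate_cochain H A m) h x :
  shift_invariant D -> kop D (fun y => f (shift h y)) x = kop D f (shift h x).
Proof.
move=> Dh; rewrite [RHS](reindex_inj (can_inj (shiftK h))).
by apply: eq_bigr => y _; rewrite Dh.
Qed.

Lemma kop_comp A l m n (D : kernel l m) (E : kernel m n)
    (f : tate_cochain H A l) : kop E (kop D f) =1 kop (kcomp D E) f.
Proof.
move=> x; rewrite /kop /kcomp.
under eq_bigr do rewrite mulrz_suml.
rewrite exchange_big; apply: eq_bigr => z _; rewrite mulrz_sumr.
by apply: eq_bigr => y _; rewrite mulrzA.
Qed.

Lemma kop_comp0 A l m n (D : kernel l m) (E : kernel m n)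
    (f : tate_cochain H A l) x :
  (forall z y, kcomp D E z y = 0) -> kop E (kop D f) x = 0.
Proof. by move=> DE; rewrite kop_comp /kop big1 // => y _;
  rewrite DE mulr0z. Qed.

Lemma kop_invariant A (act : H -> {additive A -> A}) m n (D : kernel m n) f :
  shift_invariant D -> tate_invariant act f -> tate_invariant act (kop D f).
Proof.
move=> Dh fh h x; rewrite -[LHS](@kop_shift _ _ _ D f h x Dh) -kop_nat.
by apply: kop_eq => y; exact: fh.
Qed.

End IntegerKernels.

(** * Diagram chases for a short exact sequence of coefficients *)

Section Exactness.
Variable H : finGroupType.

(* Cochains are coinduced: an invariant cochain is determined by its values    *)
(* at the tuples with first entry 1, which can be prescribed freely.           *)
Lemma lift_invariant (L A : zmodType) (actL : H -> {additive L -> L})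
    (actA : H -> {additive A -> A}) (q : L -> A) n (f : tate_cochain H A n) :
  (forall g h a, actL (g * h)%g a = actL g (actL h a)) ->
  (forall h a, actA h (actA h^-1%g a) = a) ->
  (forall h x, q (actL h x) = actA h (q x)) -> (forall a, exists x, q x = a) ->
  tate_invariant actA f ->
  exists2 f', tate_invariant actL f' & q \o f' =1 f.
Proof.
move=> actM actAK qact qsurj fh.
pose s a := projT1 (cid (qsurj a)).
have sK a : q (s a) = a by rewrite /s; case: cid.
pose f' : tate_cochain H L n := fun x =>
  actL (tnth x ord0) (s (f (shift (tnth x ord0)^-1 x))).
exists f' => [h x | x] /=; last by rewrite qact sK fh actAK.
by rewrite -/(shift h x) /f' tnth_mktuple actM -shiftM invMg mulgVK.
Qed.

Variables (M L A : zmodType) (i : {additive M -> L}) (q : {additive L -> A}).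
Variables (actM : H -> {additive M -> M}) (actL : H -> {additive L -> L}).
Variable actA : H -> {additive A -> A}.
Hypotheses (actLM : forall g h a, actL (g * h)%g a = actL g (actL h a))
  (actAK : forall h a, actA h (actA h^-1%g a) = a)
  (i_act : forall h x, i (actM h x) = actL h (i x))
  (q_act : forall h x, q (actL h x) = actA h (q x))
  (i_inj : injective i) (q_surj : forall a, exists x, q x = a)
  (kerq : forall x, q x = 0 <-> exists m, x = i m).

Lemma restrict_invariant n (f : tate_cochain H L n) :
  tate_invariant actL f -> (forall x, q (f x) = 0) ->
  exists2 g, tate_invariant actM g & i \o g =1 f.
Proof.
move=> fh qf; have qf' x : exists m, f x = i m by apply/kerq.
exists (fun x => projT1 (cid (qf' x))) => [h x | x] /=.
  by apply: i_inj; rewrite i_act; do 2!case: cid => /= ? <-; rewrite fh.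
by case: cid.
Qed.

Variables (a b c d : nat).
Variables (D1 : kernel H a b) (D2 : kernel H b c) (D3 : kernel H c d).
Hypotheses (D1h : shift_invariant D1) (D2h : shift_invariant D2).
Hypotheses (D12 : forall z y, kcomp D1 D2 z y = 0).
Hypotheses (D23 : forall z y, kcomp D2 D3 z y = 0).

(** The segment H(L) -> H(A) -> H(M) of the long exact sequence, with outer terms zero. A cocycle
    lifts to an invariant cochain of [L]; the differential of the lift comes from a cocycle of [M],
    and a primitive of the latter corrects the lift into a cocycle. *)
Lemma exact_quotient :
  tate_exact actL (@kop H L _ _ D1) (@kop H L _ _ D2) ->
  tate_exact actM (@kop H M _ _ D2) (@kop H M _ _ D3) ->
  tate_exact actA (@kop H A _ _ D1) (@kop H A _ _ D2).
Proof.
move=> exL exM f fh df0.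
have [f' fh' qf'] := lift_invariant actLM actAK q_act q_surj fh.
have [] := @restrict_invariant _ (kop D2 f').
- exact: kop_invariant.
- by move=> x; rewrite -kop_nat (kop_eq _ qf') df0.
move=> g gh ig; have [|g' [g'h dg']] := exM g gh.
  move=> x; apply: i_inj; rewrite raddf0 -kop_nat (kop_eq _ ig).
  exact: kop_comp0.
have [||e [eh de]] := exL (fun x => f' x - i (g' x)).
- by move=> h x; rewrite fh' g'h i_act raddfB.
- by move=> x; rewrite kopB kop_nat -dg' -[i _]/((i \o g) x) ig subrr.
exists (q \o e); split=> [h x /= | x]; first by rewrite eh q_act.
rewrite kop_nat -de raddfB /= -[q (f' x)]/((q \o f') x) qf'.
by rewrite (_ : q (i _) = 0) ?subr0 //; apply/kerq; exists (g' x).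
Qed.

(** The segment H(A) -> H(M) -> H(L): a primitive in [L] maps to a cocycle of [A]; subtracting the
    differential of a lifted primitive of that cocycle moves it into [M]. *)
Lemma exact_sub :
  tate_exact actA (@kop H A _ _ D1) (@kop H A _ _ D2) ->
  tate_exact actL (@kop H L _ _ D2) (@kop H L _ _ D3) ->
  tate_exact actM (@kop H M _ _ D2) (@kop H M _ _ D3).
Proof.
move=> exA exL g gh dg0.
have [||f [fh df]] := exL (i \o g).
- by move=> h x /=; rewrite gh i_act.
- by move=> x; rewrite kop_nat dg0 raddf0.
have [||e [eh de]] := exA (q \o f).
- by move=> h x /=; rewrite fh q_act.
- move=> x; rewrite kop_nat -df; apply/kerq; by exists (g x).
have [e' e'h qe'] := lift_invariant actLM actAK q_act q_surj eh.
have [] := @restrict_invariant _ (fun x => f x - kop D1 e' x).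
- by move=> h x; rewrite fh (kop_invariant D1h e'h) raddfB.
- by move=> x; rewrite raddfB -kop_nat (kop_eq _ qe') -de subrr.
move=> g' g'h ig'; exists g'; split=> // x; apply: i_inj.
by rewrite -kop_nat (kop_eq _ ig') kopB (kop_comp0 _ _ D12) subr0 -df.
Qed.

End Exactness.

(* A module with an additive map P whose conjugates under H add up to the      *)
(* identity is weakly projective: P turns a nonequivariant primitive into an   *)
(* equivariant one.                                                            *)
Lemma exact_weakly_projective (H : finGroupType) (A : zmodType)
    (act : H -> {additive A -> A}) (P : {additive A -> A}) a b c
    (D1 : kernel H a b) (D2 : kernel H b c) :
  (forall g h x, act (g * h)%g x = act g (act h x)) ->
  (forall x, \sum_h act h (P (act h^-1%g x)) = x) ->
  shift_invariant D1 ->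
  (forall f : tate_cochain H A b, kop D2 f =1 (fun=> 0) ->
     exists g, f =1 kop D1 g) ->
  tate_exact act (@kop H A _ _ D1) (@kop H A _ _ D2).
Proof.
move=> actM Pid D1h exact f fh df0.
have [|g dg] := exact (P \o f).
  by move=> x; rewrite kop_nat df0 raddf0.
exists (fun x => \sum_h act h (g (shift h^-1 x))); split=> [h x | x].
  rewrite raddf_sum (reindex_inj (mulgI h)); apply: eq_bigr => k _ /=.
  by rewrite actM -/(shift h x) -shiftM invMg mulgVK.
rewrite kop_sum -[LHS]Pid; apply: eq_bigr => h _.
rewrite (kop_nat (act h) D1 (fun y => g (shift h^-1 y))) kop_shift // -dg /=.
by congr (act h (P _)); exact/esym/fh.
Qed.

(** * The Tate differentials as kernels, and their contractions *)

Section TateKernels.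
Variable H : finGroupType.

Definition face n (i : 'I_n.+2) (x : n.+2.-tuple H) : n.+1.-tuple H :=
  [tuple tnth x (lift i j) | j < n.+1].

Definition cobound_kernel n : kernel H n n.+1 :=
  fun y x => \sum_(i < n.+2) (-1) ^+ i *+ (y == face i x).
(** Taken as the transpose of [cobound_kernel], so that shift invariance and vanishing composites
    carry over from the cochain side. *)
Definition bound_kernel n : kernel H n.+1 n := fun y x => cobound_kernel x y.
Definition norm_kernel : kernel H 0 0 := fun _ _ => 1.

Lemma face_shift n (i : 'I_n.+2) h x : face i (shift h x) = shift h (face i x).
Proof. by apply: eq_from_tnth => j; rewrite !tnth_mktuple. Qed.

Lemma cobound_kernel_shift n : shift_invariant (@cobound_kernel n).
Proof.
move=> h y x; apply: eq_bigr => i _.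
by rewrite face_shift (can_eq (shiftK h)).
Qed.

Lemma bound_kernel_shift n : shift_invariant (@bound_kernel n).
Proof. by move=> h y x; exact: cobound_kernel_shift. Qed.

Lemma norm_kernel_shift : shift_invariant norm_kernel.
Proof. by []. Qed.

Lemma face_insert n (i : 'I_n.+2) h (x : n.+1.-tuple H) :
  face i (tuple_insert i h x) = x.
Proof. by apply: eq_from_tnth => j; rewrite !tnth_mktuple liftK. Qed.

Lemma tnth_insert n (i : 'I_n.+2) h (x : n.+1.-tuple H) :
  tnth (tuple_insert i h x) i = h.
Proof. by rewrite tnth_mktuple unlift_none. Qed.

Lemma insert_face n (i : 'I_n.+2) (x : n.+2.-tuple H) :
  tuple_insert i (tnth x i) (face i x) = x.
Proof.
apply: eq_from_tnth => j; rewrite tnth_mktuple.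
by case: unliftP => [k ->|->] //; rewrite tnth_mktuple.
Qed.

Variable A : zmodType.

Lemma tate_coboundE n : @tate_cobound H A n = kop (@cobound_kernel n).
Proof.
apply/funext => f; apply/funext => x; rewrite /kop.
under [RHS]eq_bigr do rewrite mulrz_sumr.
rewrite exchange_big; apply: eq_bigr => i _ /=.
rewrite (bigD1 (face i x)) //= eqxx mulr1n big1 ?addr0 //.
by move=> y /negPf ->; rewrite mulr0n mulr0z.
Qed.

Lemma tate_boundE n : @tate_bound H A n = kop (@bound_kernel n).
Proof.
apply/funext => f; apply/funext => x; rewrite /kop.
under [RHS]eq_bigr do rewrite mulrz_sumr.
rewrite exchange_big; apply: eq_bigr => i _ /=.
(* The fibre of [face i] over [x] consists of the insertions of some [h] into [x] at position
   [i]. *)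
rewrite (bigID [pred y | x == face i y]) /= [X in _ + X]big1 ?addr0; last first.
  by move=> y /negPf ->; rewrite mulr0n mulr0z.
rewrite mulrz_suml (reindex_onto (fun h => tuple_insert i h x)
  (fun y => tnth y i)) /=; last by move=> y /eqP ->; rewrite insert_face.
apply: eq_big => h; first by rewrite face_insert tnth_insert !eqxx.
by rewrite face_insert eqxx mulr1n.
Qed.

Lemma tate_normE : @tate_norm H A = kop norm_kernel.
Proof.
apply/funext => f; apply/funext => x; rewrite /kop /tate_norm.
rewrite (reindex (fun h : H => [tuple h])); last first.
  exists (fun y => tnth y ord0) => [h _ | y _]; first by [].
  by apply: eq_from_tnth => i; rewrite (ord1 i).
by apply: eq_bigr => h _; rewrite mulr1z.
Qed.

Lemma lift_lift0 n (i : 'I_n.+2) (j : 'I_n.+1) :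
  lift (lift ord0 i) (lift ord0 j) = lift ord0 (lift i j).
Proof. by apply: val_inj; rewrite /= /bump /= !add1n ltnS addnS. Qed.

Lemma lift_lift_ord0 n (i : 'I_n.+1) : lift (lift ord0 i) ord0 = ord0 :>
  'I_n.+2.
Proof. exact: val_inj. Qed.

Lemma face0_cons n h (x : n.+1.-tuple H) : face ord0 (cons_tuple h x) = x.
Proof. by apply: eq_from_tnth => j; rewrite tnth_mktuple tnthS. Qed.

Lemma faceS_cons n i h (x : n.+2.-tuple H) :
  face (lift ord0 i) (cons_tuple h x) = cons_tuple h (face i x).
Proof.
apply: eq_from_tnth => j; rewrite tnth_mktuple.
case: (unliftP ord0 j) => [k ->|->].
  by rewrite lift_lift0 !tnthS tnth_mktuple.
by rewrite lift_lift_ord0 !tnth0.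
Qed.

(** The cone homotopy: fixing the first entry contracts the complex of all cochains. It gives both
    acyclicity and, by induction on the degree, the vanishing of the double coboundary. *)
Lemma cobound_cons n (f : tate_cochain H A n.+1) h x :
  tate_cobound f (cons_tuple h x) =
  f x - tate_cobound (fun y => f (cons_tuple h y)) x.
Proof.
rewrite /tate_cobound big_ord_recl -/(face _ _) face0_cons expr0 mulr1z.
congr (_ + _); rewrite -sumrN; apply: eq_bigr => i _.
by rewrite -/(face _ _) faceS_cons exprS mulN1r mulrNz.
Qed.

Lemma cobound_cons0 (f : tate_cochain H A 0) h x :
  tate_cobound f (cons_tuple h x) = f x - f [tuple h].
Proof.
rewrite /tate_cobound big_ord_recl big_ord1 -!/(face _ _) face0_cons.
rewrite expr0 expr1 mulr1z mulrN1z; congr (_ - f _).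
by apply: eq_from_tnth => -[[|//] lti]; rewrite tnth_mktuple !(tnth_nth h).
Qed.

Lemma cobound_shift n (f : tate_cochain H A n) h x :
  tate_cobound (fun y => f (shift h y)) x = tate_cobound f (shift h x).
Proof. by rewrite tate_coboundE kop_shift //; exact: cobound_kernel_shift. Qed.

Lemma tate_coboundB n (f g : tate_cochain H A n) x :
  tate_cobound (fun y => f y - g y) x = tate_cobound f x - tate_cobound g x.
Proof. by rewrite tate_coboundE kopB. Qed.

Lemma cobound_const (a : A) x : tate_cobound (fun _ : 1.-tuple H => a) x = 0.
Proof. by rewrite /tate_cobound big_ord_recl big_ord1 expr0 expr1 mulr1z
  mulrN1z subrr. Qed.

Lemma shift_cons n (x : n.+2.-tuple H) :
  exists y, x = shift (tnth x ord0) (cons_tuple 1%g y).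
Proof.
pose z := shift (tnth x ord0)^-1 x.
exists (face ord0 z); rewrite -[LHS](shiftVK (tnth x ord0)) -/z.
congr shift; apply: eq_from_tnth => i.
case: (unliftP ord0 i) => [k ->|->]; first by rewrite tnthS !tnth_mktuple.
by rewrite tnth0 tnth_mktuple mulVg.
Qed.

Lemma cobound_cobound n (f : tate_cochain H A n) x :
  tate_cobound (tate_cobound f) x = 0.
Proof.
have [y ->] := shift_cons x; rewrite -cobound_shift.
set h := tnth x ord0; pose g z := f (shift h z).
have -> : (fun z => tate_cobound f (shift h z)) = tate_cobound g.
  by apply/funext => z; rewrite cobound_shift.
move: g => {x f h} f; elim: n f y => [|n IHn] f y; rewrite cobound_cons.
  rewrite (_ : (fun z => _) = fun z => f z - f [tuple 1%g]).
    by rewrite tate_coboundB cobound_const subr0 subrr.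
  by apply/funext => z; rewrite cobound_cons0.
rewrite (_ : (fun z => _) =
  fun z => f z - tate_cobound (fun t => f (cons_tuple 1%g t)) z).
  rewrite tate_coboundB opprB addrC subrK.
  have [y' ->] := shift_cons y; rewrite -cobound_shift.
  set h := tnth y ord0; set k := fun t => f _.
  rewrite (_ : (fun z => _) = tate_cobound (fun t => k (shift h t))) ?IHn //.
  by apply/funext => z; rewrite cobound_shift.
by apply/funext => z; rewrite cobound_cons.
Qed.

Lemma insertS_face n i h (x : n.+2.-tuple H) :
  face ord0 (tuple_insert (lift ord0 i) h x) = tuple_insert i h (face ord0 x).
Proof.
apply: eq_from_tnth => j; rewrite !tnth_mktuple.
case: (unliftP i j) => [k ->|->]; last by rewrite unlift_none.
by rewrite -lift_lift0 liftK tnth_mktuple.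
Qed.

Lemma insertS_tnth0 n i h (x : n.+1.-tuple H) :
  tnth (tuple_insert (lift ord0 i) h x) ord0 = tnth x ord0.
Proof. by rewrite tnth_mktuple -[X in unlift _ X](lift_lift_ord0 i) liftK. Qed.

(** The dual cone: [f] is placed on the tuples starting with 1. Its boundary is [f] up to a term
    that vanishes on cycles. *)
Definition extend1 n (f : tate_cochain H A n) : tate_cochain H A n.+1 :=
  fun y => f (face ord0 y) *+ (tnth y ord0 == 1%g).

Lemma bound_extend1_recl n (f : tate_cochain H A n) x :
  tate_bound (extend1 f) x = f x - (\sum_(i < n.+1) (\sum_h
    f (face ord0 (tuple_insert (lift ord0 i) h x))) *~ (-1) ^+ i)
      *+ (tnth x ord0 == 1%g).
Proof.
rewrite /tate_bound big_ord_recl expr0 mulr1z (bigD1 1%g) //= big1 ?addr0.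
  rewrite /extend1 face_insert tnth_insert eqxx mulr1n; congr (_ + _).
  rewrite -sumrMnl -sumrN; apply: eq_bigr => i _.
  rewrite exprS mulN1r mulrNz; congr (- _).
  under eq_bigr do rewrite /extend1 insertS_tnth0.
  by rewrite sumrMnl; case: eqP => _; rewrite ?mulr1n ?mulr0n ?mul0rz.
by move=> h /negPf h1; rewrite /extend1 tnth_insert h1.
Qed.

End TateKernels.

(** * Acyclicity without invariants, weak projectivity and the long exact sequence *)

Section TateComplex.
Variable H : finGroupType.

(** Integer-valued point masses recover a kernel from its operator, so identities between cochains
    become identities between kernels. *)
Lemma kcomp_kop l m n (D : kernel H l m) (E : kernel H m n) z x :
  kcomp D E z x = kop E (kop D (fun w => (w == z)%:R : int)) x.
Proof.
apply: eq_bigr => y _; rewrite mulrzz /kop (bigD1 z) //= eqxx big1 ?addr0.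
  by rewrite mulrzz mul1r.
by move=> w /negPf ->; rewrite mul0rz.
Qed.

Lemma cobound_cobound_kernel n z x :
  kcomp (@cobound_kernel H n) (@cobound_kernel H n.+1) z x = 0.
Proof. by rewrite kcomp_kop -!tate_coboundE cobound_cobound. Qed.

Lemma bound_bound_kernel n z x :
  kcomp (@bound_kernel H n.+1) (@bound_kernel H n) z x = 0.
Proof.
rewrite -[RHS](cobound_cobound_kernel x z).
by apply: eq_bigr => y _; rewrite mulrC.
Qed.

Lemma norm_cobound_kernel z x :
  kcomp (@norm_kernel H) (@cobound_kernel H 0) z x = 0.
Proof.
rewrite -[RHS](cobound_const (1 : int) x) tate_coboundE.
by apply: eq_bigr => y _; rewrite mulrzz.
Qed.

Lemma bound_norm_kernel z x :
  kcomp (@bound_kernel H 0) (@norm_kernel H) z x = 0.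
Proof.
rewrite -[RHS](norm_cobound_kernel x z).
by apply: eq_bigr => y _; rewrite mulrC.
Qed.

Section Acyclic.
Variable A : zmodType.

Lemma cobound_acyclic n (f : tate_cochain H A n.+1) :
  tate_cobound f =1 (fun=> 0) -> exists g, f =1 tate_cobound g.
Proof.
move=> df; exists (fun y => f (cons_tuple 1%g y)) => x.
by apply/eqP; rewrite -subr_eq0 -cobound_cons df.
Qed.

(** A closed 0-cochain is constant, and a constant is the norm of a cochain concentrated at 1. *)
Lemma cobound_norm_acyclic (f : tate_cochain H A 0) :
  tate_cobound f =1 (fun=> 0) -> exists g, f =1 tate_norm g.
Proof.
move=> df; exists (fun y => f [tuple 1%g] *+ (tnth y ord0 == 1%g)) => x.
rewrite /tate_norm (bigD1 1%g) //= (tnth_nth 1%g) [_ == 1%g]eqxx big1 ?addr0.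
  by apply/eqP; rewrite -subr_eq0 -cobound_cons0 df.
by move=> h /negPf h1; rewrite (tnth_nth 1%g) [_ == 1%g]h1.
Qed.

Lemma norm_bound_acyclic (f : tate_cochain H A 0) :
  tate_norm f =1 (fun=> 0) -> exists g, f =1 tate_bound g.
Proof.
move=> df; exists (extend1 f) => x;
  rewrite bound_extend1_recl big_ord1 expr0 mulr1z.
rewrite (_ : \sum_h _ = 0) ?mul0rn ?subr0 //.
rewrite -[RHS](df x); apply: eq_bigr => h _; congr f; apply: eq_from_tnth => j.
rewrite tnth_mktuple (_ : lift ord0 j = lift ord0 ord0) ?tnth_insert.
  by rewrite (ord1 j) !(tnth_nth 1%g).
by rewrite (ord1 j); exact: val_inj.
Qed.

Lemma bound_acyclic n (f : tate_cochain H A n.+1) :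
  tate_bound f =1 (fun=> 0) -> exists g, f =1 tate_bound g.
Proof.
move=> df; exists (extend1 f) => x; rewrite bound_extend1_recl.
rewrite (_ : \sum_i _ = 0) ?mul0rn ?subr0 // -[RHS](df (face ord0 x)).
apply: eq_bigr => i _; congr (_ *~ _).
by apply: eq_bigr => h _; rewrite insertS_face.
Qed.

End Acyclic.

Lemma weakly_projective_tate (A : zmodType) (act : H -> {additive A -> A})
    (P : {additive A -> A}) (n : int) :
  (forall g h x, act (g * h)%g x = act g (act h x)) ->
  (forall x, \sum_h act h (P (act h^-1%g x)) = x) ->
  tate_vanishes act n.
Proof.
move=> actM Pid; case: n => [[|n]|[|n]]; rewrite /tate_vanishes.
- rewrite tate_coboundE tate_normE.
  apply: exact_weakly_projective actM Pid (@norm_kernel_shift _) _.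
  by rewrite -tate_coboundE -tate_normE; exact: cobound_norm_acyclic.
- rewrite !tate_coboundE.
  apply: exact_weakly_projective actM Pid (@cobound_kernel_shift _ _) _.
  by rewrite -!tate_coboundE; exact: cobound_acyclic.
- rewrite tate_boundE tate_normE.
  apply: exact_weakly_projective actM Pid (@bound_kernel_shift _ _) _.
  by rewrite -tate_boundE -tate_normE; exact: norm_bound_acyclic.
- rewrite !tate_boundE.
  apply: exact_weakly_projective actM Pid (@bound_kernel_shift _ _) _.
  by rewrite -!tate_boundE; exact: bound_acyclic.
Qed.

Section LongExactSequence.
Variables (M L A : zmodType) (i : {additive M -> L}) (q : {additive L -> A}).
Variables (actM : H -> {additive M -> M}) (actL : H -> {additive L -> L}).
Variable actA : H -> {additive A -> A}.
Hypotheses (actLM : forall g h a, actL (g * h)%g a = actL g (actL h a))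
  (actAK : forall h a, actA h (actA h^-1%g a) = a)
  (i_act : forall h x, i (actM h x) = actL h (i x))
  (q_act : forall h x, q (actL h x) = actA h (q x))
  (i_inj : injective i) (q_surj : forall a, exists x, q x = a)
  (kerq : forall x, q x = 0 <-> exists m, x = i m).
Hypothesis vanL : forall n, tate_vanishes actL n.

Let cos := @cobound_kernel_shift H.
Let bos := @bound_kernel_shift H.
Let nos := @norm_kernel_shift H.
Let coco := @cobound_cobound_kernel.
Let bobo := @bound_bound_kernel.
Let noco := @norm_cobound_kernel.
Let bono := @bound_norm_kernel.
Let quot := exact_quotient actLM actAK i_act q_act i_inj q_surj kerq.
Let sub := exact_sub actLM actAK i_act q_act i_inj q_surj kerq.

Lemma tate_quotient :
  (forall n, tate_vanishes actM n) -> forall n, tate_vanishes actA n.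
Proof.
move=> vanM [[|m]|[|[|m]]]; rewrite /tate_vanishes.
- move: (vanL (Posz 0)) (vanM (Posz 1)).
  by rewrite /tate_vanishes !tate_normE !tate_coboundE;
    exact: (quot (@cos _) (@coco _)).
- move: (vanL m.+1%:Z) (vanM m.+2%:Z).
  by rewrite /tate_vanishes !tate_coboundE; exact: (quot (@cos _) (@coco _)).
- move: (vanL (Negz 0)) (vanM (Posz 0)).
  by rewrite /tate_vanishes !tate_normE !tate_boundE !tate_coboundE;
    exact: (quot nos noco).
- move: (vanL (Negz 1)) (vanM (Negz 0)).
  by rewrite /tate_vanishes !tate_normE !tate_boundE;
    exact: (quot (@bos _) bono).
- move: (vanL (Negz m.+2)) (vanM (Negz m.+1)).
  by rewrite /tate_vanishes !tate_boundE; exact: (quot (@bos _) (@bobo _)).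
Qed.

Lemma tate_sub :
  (forall n, tate_vanishes actA n) -> forall n, tate_vanishes actM n.
Proof.
move=> vanA [[|[|m]]|[|m]]; rewrite /tate_vanishes.
- move: (vanA (Negz 0)) (vanL (Posz 0)).
  by rewrite /tate_vanishes !tate_normE !tate_boundE !tate_coboundE;
    exact: (sub (@bos _) bono).
- move: (vanA (Posz 0)) (vanL (Posz 1)).
  by rewrite /tate_vanishes !tate_normE !tate_coboundE; exact: (sub nos noco).
- move: (vanA m.+1%:Z) (vanL m.+2%:Z).
  by rewrite /tate_vanishes !tate_coboundE; exact: (sub (@cos _) (@coco _)).
- move: (vanA (Negz 1)) (vanL (Negz 0)).
  by rewrite /tate_vanishes !tate_normE !tate_boundE;
    exact: (sub (@bos _) (@bobo _)).
- move: (vanA (Negz m.+2)) (vanL (Negz m.+1)).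
  by rewrite /tate_vanishes !tate_boundE; exact: (sub (@bos _) (@bobo _)).
Qed.

End LongExactSequence.

End TateComplex.

(** * Local rings with principal maximal ideal; here [p] denotes the uniformizer *)

Section LocalRing.
Variables (R : comNzRingType) (pi : uniformizer R).
Local Notation p := (unif pi).

Fact residue_zmod_morphism : zmod_morphism (@residue R pi).
Proof. by move=> x y; rewrite /residue raddfB. Qed.
Fact residue_monoid_morphism : monoid_morphism (@residue R pi).
Proof. by split=> [|x y]; rewrite ?residue1 ?residueM. Qed.
HB.instance Definition _ := GRing.isZmodMorphism.Build R (residueField pi)
  (@residue R pi) residue_zmod_morphism.
HB.instance Definition _ := GRing.isMonoidMorphism.Build R (residueField pi)
  (@residue R pi) residue_monoid_morphism.

Lemma residue_eq0 r : residue pi r = 0 <-> exists t, r = p * t.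
Proof. by rewrite -residue0 residue_eq subr0. Qed.

Lemma unit_of_residue r : residue pi r <> 0 -> exists s, r * s = 1.
Proof.
move=> r0; apply: contrapT => /(unifP pi) hr; apply: r0.
by apply/residue_eq0.
Qed.

Lemma unit_1B r : exists s, (1 - p * r) * s = 1.
Proof.
apply: unit_of_residue; rewrite raddfB /= residue1 (_ : residue pi (p * r) = 0).
  by rewrite subr0; apply/eqP; exact: oner_neq0.
by apply/residue_eq0; exists r.
Qed.

(** A valuation truncated at [m]: it is obtained by dividing at most [m] times, with no appeal to
    the intersection of all powers of the maximal ideal. *)
Lemma unif_power m r :
  (exists s, r = p ^+ m * s) \/
  (exists k u v, [/\ (k < m)%N, u * v = 1 & r = p ^+ k * u]).
Proof.
elim: m => [|m [[s ->]|[k [u [v [km uv ->]]]]]].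
- by left; exists r; rewrite mul1r.
- case: (pselect (exists y, s * y = 1)) => [[y sy]|/(unifP pi) [t ->]].
    by right; exists m, s, y.
  by left; exists t; rewrite exprSr mulrA.
- by right; exists k, u, v; rewrite leqW.
Qed.

Lemma left_inverse_of_residue n (A : 'M[R]_n) :
  map_mx (residue pi) A = 1%:M -> exists B, B *m A = 1%:M.
Proof.
move=> A1; have [|s ds] := @unit_of_residue (\det A).
  by rewrite -det_map_mx A1 det1; apply/eqP; exact: oner_neq0.
exists (s *: \adj A); rewrite -scalemxAl mul_adj_mx scale_scalar_mx mulrC ds.
by [].
Qed.

(* Echelon form: the first coordinates of U form an ideal containing a power   *)
(* of the uniformizer, hence generated by a power of it.                       *)
Lemma echelon_basis n (U : 'rV[R]_n -> Prop) m :
  (forall x, p * x = 0 -> x = 0) ->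
  (forall a u v, U u -> U v -> U (a *: u + v)) ->
  (forall v, U (p ^+ m *: v)) ->
  exists X : 'M[R]_n, [/\ forall k, U (row k X),
    forall v, U v -> exists u, v = u *m X
    & forall u : 'rV_n, u *m X = 0 -> u = 0].
Proof.
move=> preg; elim: n U => [|n IHn] U Ulin Um.
  exists 0; split=> [[] //|v _|u _]; last by rewrite thinmx0.
  by exists 0; rewrite !thinmx0.
move: U Ulin Um; rewrite -[n.+1]/(1 + n)%N => U Ulin Um.
have U0 : U 0 by rewrite -(scaler0 _ (p ^+ m)).
have [||X' [X'U X'span X'free]] := IHn (fun v => U (row_mx (0 : 'M_1) v)).
- by move=> a u v uU vU; have := Ulin a _ _ uU vU;
  rewrite scale_row_mx add_row_mx scaler0 addr0.
- by move=> v; have := Um (row_mx (0 : 'M_1) v); rewrite scale_row_mx scaler0.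
pose J a := exists v : 'rV_n, U (row_mx (a%:M : 'M_1) v).
have exJ : exists k, `[< J (p ^+ k) >].
  exists m; apply/asboolP; exists 0.
  by have := Um (row_mx 1%:M 0);
    rewrite scale_row_mx scaler0 scale_scalar_mx mulr1.
case: (ex_minnP exJ) => k /asboolP [w wU] kmin.
have Jk a : J a -> exists b, a = p ^+ k * b.
  move=> [v vU]; case: (unif_power k a) => // -[j [u [u' [jk uu' aE]]]].
  suff jJ : J (p ^+ j) by move/asboolP: jJ => /kmin; rewrite leqNgt jk.
  exists (u' *: v).
  have := Ulin u' _ _ vU U0; rewrite addr0 scale_row_mx scale_scalar_mx aE.
  by rewrite mulrCA (mulrC u') uu' mulr1.
have pkreg x : p ^+ k * x = 0 -> x = 0.
  elim: k {kmin wU Jk} x => [|k IHk] x; first by rewrite mul1r.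
  by rewrite exprSr -mulrA => /IHk /preg.
(* The first row is a vector of [U] whose first coordinate generates the ideal [J]; below it stands
   the basis of the vectors of [U] with first coordinate 0. *)
exists (block_mx (p ^+ k)%:M w 0 X'); split=> [i|v vU|u].
- rewrite -(splitK i); case: (split i) => j /=.
    by rewrite rowKu (ord1 j) row_row_mx !row_id.
  by rewrite rowKd row_row_mx row0.
- rewrite -[v](@hsubmxK _ _ 1 n); set v1 := lsubmx _; set v2 := rsubmx _.
  have v1E : v1 = (v1 0 0)%:M by rewrite -mx11_scalar.
  have [|b bE] := Jk (v1 0 0).
    by exists v2; rewrite -v1E /v1 /v2 hsubmxK.
  have [|u' u'E] := X'span (v2 - b *: w).
    have := Ulin (- b) _ _ wU vU; rewrite -{1}[v](@hsubmxK _ _ 1 n) -/v1 -/v2.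
    rewrite scale_row_mx add_row_mx (addrC _ v2) (_ : _ + v1 = 0) ?scaleNr //.
    apply/matrixP => i j; rewrite v1E !ord1 bE !mxE eqxx.
    by rewrite mulr1n (mulrC b) addNr.
  exists (row_mx b%:M u'); rewrite mul_row_block mulmx0 addr0 -u'E v1E bE.
  by rewrite -scalar_mxM mulrC mul_scalar_mx addrC subrK.
- rewrite -[u](@hsubmxK _ _ 1 n) mul_row_block mulmx0 addr0.
  set u1 := lsubmx _; set u2 := rsubmx _ => /eqP.
  rewrite -[0](@row_mx0 _ 1 1 n) => /eqP /eq_row_mx [u1p u2X].
  have u10 : u1 = 0.
    rewrite (mx11_scalar u1) in u1p *.
    rewrite -scalar_mxM in u1p; have /matrixP /(_ 0 0) := u1p.
    by rewrite !mxE eqxx mulr1n mulrC => /pkreg ->; rewrite raddf0.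
  by move: u2X; rewrite u10 mul0mx add0r => /X'free ->; rewrite row_mx0.
Qed.

End LocalRing.

(** * Spanning and independent families, Nakayama's lemma, submodules of full rank *)

Section Families.
Variables (R : comNzRingType) (pi : uniformizer R).
Local Notation p := (unif pi).
Implicit Types (W : lmodType R) (I J : finType).

Definition lincomb W I (x : I -> W) (u : I -> R) : W := \sum_i u i *: x i.
Definition spanning W I (x : I -> W) := forall w, exists u, w = lincomb x u.
Definition independent W I (x : I -> W) :=
  forall u, lincomb x u = 0 -> u =1 (fun=> 0).
Definition basis W I (x : I -> W) := spanning x /\ independent x.

Lemma lincombD W I (x : I -> W) u v :
  lincomb x (fun i => u i + v i) = lincomb x u + lincomb x v.
Proof. by rewrite -big_split; apply: eq_bigr => i _; rewrite scalerDl. Qed.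

Lemma lincombB W I (x : I -> W) u v :
  lincomb x (fun i => u i - v i) = lincomb x u - lincomb x v.
Proof. by rewrite -sumrB; apply: eq_bigr => i _; rewrite scalerBl. Qed.

Lemma lincombZ W I (x : I -> W) a u :
  lincomb x (fun i => a * u i) = a *: lincomb x u.
Proof. by rewrite scaler_sumr; apply: eq_bigr => i _; rewrite scalerA. Qed.

Lemma lincomb_delta W I (x : I -> W) i :
  lincomb x (fun j => (j == i)%:R) = x i.
Proof.
rewrite /lincomb (bigD1 i) //= eqxx scale1r big1 ?addr0 //.
by move=> j /negPf ->; rewrite scale0r.
Qed.

Lemma lincomb_lincomb W I J (x : I -> W) (y : J -> W) X u :
  (forall i, x i = lincomb y (X i)) ->
  lincomb x u = lincomb y (fun j => \sum_i u i * X i j).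
Proof.
move=> xE; rewrite /lincomb.
under eq_bigr do rewrite xE scaler_sumr.
rewrite exchange_big; apply: eq_bigr => j _; rewrite scaler_suml.
by apply: eq_bigr => i _; rewrite scalerA.
Qed.

Lemma independent_inj W I (x : I -> W) u v :
  independent x -> lincomb x u = lincomb x v -> u =1 v.
Proof.
move=> xfree /eqP; rewrite -subr_eq0 -lincombB => /eqP /xfree uv i.
by apply/eqP; rewrite -subr_eq0 uv.
Qed.

Definition fam_mx I J (X : I -> J -> R) : 'M[R]_(#|I|, #|J|) :=
  \matrix_(i, j) X (enum_val i) (enum_val j).

Lemma sum_enum_val (V : nmodType) I (F : I -> V) :
  \sum_i F i = \sum_(k < #|I|) F (enum_val k).
Proof. by rewrite (reindex _ (onW_bij _ (enum_val_bij I))). Qed.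

Lemma fam_mxM I J (K : finType) (X : I -> J -> R) (Y : J -> K -> R) :
  fam_mx X *m fam_mx Y = fam_mx (fun i k => \sum_j X i j * Y j k).
Proof.
apply/matrixP => i k; rewrite !mxE [RHS]sum_enum_val.
by apply: eq_bigr => j _; rewrite !mxE.
Qed.

Lemma fam_mx1 I (X : I -> I -> R) :
  (fam_mx X = 1%:M) <-> (forall i j, X i j = (j == i)%:R).
Proof.
split=> [/matrixP X1 i j | X1].
  have := X1 (enum_rank i) (enum_rank j); rewrite !mxE !enum_rankK => ->.
  by rewrite (inj_eq (can_inj (@enum_rankK I))) eq_sym.
by apply/matrixP => i j; rewrite !mxE X1 (inj_eq enum_val_inj) eq_sym.
Qed.

Lemma fam_mx_surj I J (A : 'M[R]_(#|I|, #|J|)) : exists X, A = fam_mx X.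
Proof.
exists (fun i j => A (enum_rank i) (enum_rank j)).
by apply/matrixP => i j; rewrite mxE !enum_valK.
Qed.

Lemma spanning_coords W I J (x : I -> W) (y : J -> W) :
  spanning y -> exists X, forall i, x i = lincomb y (X i).
Proof.
move=> ysp; exists (fun i => projT1 (cid (ysp (x i)))) => i.
by case: cid.
Qed.

Lemma basis_change W I J (x : I -> W) (y : J -> W) :
  basis y -> spanning x ->
  exists X Y, [/\ forall i, x i = lincomb y (X i),
    forall j, y j = lincomb x (Y j) & fam_mx Y *m fam_mx X = 1%:M].
Proof.
move=> [ysp yfree] xsp.
have [X xE] := spanning_coords x ysp; have [Y yE] := spanning_coords y xsp.
exists X, Y; split=> //; rewrite fam_mxM; apply/fam_mx1 => j;
  apply: (independent_inj yfree); rewrite lincomb_delta yE.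
by rewrite (lincomb_lincomb _ xE).
Qed.

Lemma basis_le_spanning W I J (x : I -> W) (y : J -> W) :
  basis y -> spanning x -> (#|J| <= #|I|)%N.
Proof.
by move=> yb xsp; have [X [Y [_ _ /mulmx1_min]]] := basis_change yb xsp.
Qed.

(** The two families have the same index type, so the change of coordinates is square, and over a
    commutative ring a one-sided inverse is two-sided. *)
Lemma spanning_basis W I (x y : I -> W) : basis y -> spanning x -> basis x.
Proof.
move=> yb xsp; split=> // u xu0 i.
have [X [Y [xE yE /mulmx1C]]] := basis_change yb xsp.
rewrite fam_mxM => /fam_mx1 XY.
have uX j : \sum_i u i * X i j = 0.
  apply: (yb.2 (fun j => \sum_i u i * X i j)).
  by rewrite -(lincomb_lincomb _ xE).
have : \sum_j (\sum_k u k * X k j) * Y j i = 0.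
  by apply: big1 => j _; rewrite uX mul0r.
under eq_bigr do rewrite big_distrl /=.
rewrite exchange_big /= (eq_bigr (fun k => u k * (i == k)%:R)) => [|k _].
  rewrite (bigD1 i) //= eqxx mulr1 big1 ?addr0 // => k /negPf ki.
  by rewrite eq_sym ki mulr0.
by rewrite -XY big_distrr /=; apply: eq_bigr => j _; rewrite mulrA.
Qed.

(** Independence of the classes in W / p W over the residue field, written without forming the
    quotient. *)
Definition residually_independent W I (x : I -> W) :=
  forall u w, lincomb x u = p *: w -> forall i, exists t, u i = p * t.

Lemma residually_independent_le W I J (x : I -> W) (y : J -> W) :
  spanning y -> residually_independent x -> (#|I| <= #|J|)%N.
Proof.
move=> ysp xfree; have [X xE] := spanning_coords x ysp.
pose A := map_mx (residue pi) (fam_mx X).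
suff /eqP <- : row_free A by exact: rank_leq_col.
apply: inj_row_free => v vA0.
pose u i := residue_lift (v 0 (enum_rank i)).
have uX j : exists t, \sum_i u i * X i j = p * t.
  apply/residue_eq0; rewrite raddf_sum sum_enum_val.
  have /matrixP /(_ 0 (enum_rank j)) := vA0; rewrite !mxE => {2}<-.
  apply: eq_bigr => k _.
  by rewrite /= residueM /u enum_valK residue_liftK !mxE enum_rankK.
pose t j := projT1 (cid (uX j)).
have tE j : \sum_i u i * X i j = p * t j by rewrite /t; case: cid.
have := @xfree u (lincomb y t).
rewrite (lincomb_lincomb _ xE) -lincombZ.
have -> : (fun j => \sum_i u i * X i j) = (fun j => p * t j) by apply/funext.
move=> /(_ erefl) ut; apply/rowP => k; rewrite mxE.
have /(residue_eq0 pi) := ut (enum_val k).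
by rewrite /u residue_liftK enum_valK.
Qed.

Lemma nakayama W J (y : J -> W) (U : W -> Prop) :
  spanning y -> U 0 -> (forall a v w, U v -> U w -> U (a *: v + w)) ->
  (forall w, exists v w', U v /\ w = v + p *: w') -> forall w, U w.
Proof.
move=> ysp U0 Ulin UV.
pose v j := projT1 (cid (UV (y j))).
pose w j := projT1 (cid (projT2 (cid (UV (y j))))).
have vU j : U (v j) by rewrite /v; case: cid => ? /= [? []].
have yE j : y j = v j + p *: w j.
  by rewrite /v /w; case: cid => /= ? ?; case: cid => /= ? [].
have [C wE] := spanning_coords w ysp.
have vE j : v j = lincomb y (fun k => (k == j)%:R - p * C j k).
  by rewrite lincombB lincombZ lincomb_delta -wE yE addrK.
(* The matrix 1 - p C expresses the [v j] through the generators [y]; it is the identity modulo [p],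
   hence invertible, so the [y j] lie in [U]. *)
pose X j k := (k == j)%:R - p * C j k.
have [D' DX] : exists D, D *m fam_mx X = 1%:M.
  apply: (@left_inverse_of_residue _ pi); apply/matrixP => i j; rewrite !mxE.
  rewrite raddfB /= (_ : residue pi (p * _) = 0) ?subr0.
    by rewrite (inj_eq enum_val_inj) eq_sym rmorph_nat.
  by apply/residue_eq0; exists (C (enum_val i) (enum_val j)).
have [D DE] := fam_mx_surj D'; move: DX; rewrite DE fam_mxM => /fam_mx1 DX.
have Usum (u : J -> R) : U (lincomb v u).
  rewrite /lincomb; elim: (index_enum J) => [|j s IHs]; rewrite ?big_nil //.
  by rewrite big_cons; exact: Ulin.
have yU j : y j = lincomb v (D j).
  rewrite (lincomb_lincomb _ vE) -[LHS]lincomb_delta.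
  by congr lincomb; apply/funext => k; rewrite DX.
move=> z; have [u ->] := ysp z.
by rewrite (lincomb_lincomb _ yU); exact: Usum.
Qed.

(** In the coordinates of [y] the image of [f] contains p^m R^J, so [echelon_basis] applies. Keeping
    the index type [J] records that the rank does not change. *)
Lemma basis_of_full_submodule (M L : lmodType R) (f : {linear M -> L}) J
    (y : J -> L) m :
  (forall x, p * x = 0 -> x = 0) -> injective f -> basis y ->
  (forall l, exists x, f x = p ^+ m *: l) -> exists x : J -> M, basis x.
Proof.
move=> preg finj [ysp yfree] fm.
pose g (v : 'rV[R]_#|J|) := lincomb y (fun j => v 0 (enum_rank j)).
have gZD a u v : g (a *: u + v) = a *: g u + g v.
  by rewrite -lincombZ -lincombD; congr lincomb; apply/funext => j;
    rewrite !mxE.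
have [||X [XU Xsp Xfree]] :=
  @echelon_basis _ pi _ (fun v => exists x, f x = g v) m preg.
- by move=> a u v [x fx] [z fz]; exists (a *: x + z); rewrite linearP fx fz gZD.
- move=> v; have [x fx] := fm (g v); exists x.
  rewrite fx -[p ^+ m *: v]addr0 gZD -[LHS]addr0; congr (_ + _); symmetry.
  by rewrite /g /lincomb big1 ?addr0 // => j _; rewrite mxE scale0r.
pose x j := projT1 (cid (XU (enum_rank j))).
have xE j : f (x j) = g (row (enum_rank j) X) by rewrite /x; case: cid.
have fx u : f (lincomb x u) = g ((\row_k u (enum_val k)) *m X).
  rewrite linear_sum /=; under eq_bigr do rewrite linearZ /= xE.
  rewrite -/(lincomb _ u) (@lincomb_lincomb _ _ _ _ y (fun i j => X (enum_rank
    i) (enum_rank j))).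
    congr lincomb; apply/funext => j; rewrite mxE sum_enum_val.
    by apply: eq_bigr => k _; rewrite mxE enum_valK.
  by move=> i; congr lincomb; apply/funext => j; rewrite mxE.
exists x; split=> [w | u xu0 i].
  have [c wc] := ysp (f w).
  have gc : g (\row_k c (enum_val k)) = f w.
    by rewrite wc; congr lincomb; apply/funext => j; rewrite mxE enum_rankK.
  have [|u uE] := Xsp (\row_k c (enum_val k)); first by exists w.
  exists (fun j => u 0 (enum_rank j)); apply: finj; rewrite fx -gc uE.
  by congr (g (_ *m X)); apply/rowP => k; rewrite mxE enum_valK.
have /Xfree /rowP /(_ (enum_rank i)) : (\row_k u (enum_val k)) *m X = 0.
  have /yfree h : g ((\row_k u (enum_val k)) *m X) = 0 by rewrite -fx xu0
    linear0.
  by apply/rowP => k; have := h (enum_val k); rewrite enum_valK mxE => ->;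
    rewrite mxE.
by rewrite !mxE enum_rankK.
Qed.

End Families.

(** * The group ring and its augmentation ideal *)

Section GroupRingBasics.
Variables (R : comNzRingType) (gT : finGroupType).
Local Notation RG := (groupRing R gT).
Local Notation delta := (gr_delta R).
Local Notation const := (gr_const gT).

Lemma gr_const1 : const 1 = 1 :> RG. Proof. by []. Qed.

Lemma gr_delta1 : delta 1%g = 1 :> RG.
Proof. by apply: gr_ext => x; rewrite gr_deltaE. Qed.

Lemma gr_delta_mulE (g : gT) (u : RG) x : gr_fun (delta g * u) x = gr_fun u
  (g^-1 * x)%g.
Proof.
rewrite [LHS]gr_mulE (bigD1 g) //= gr_deltaE eqxx mul1r big1 ?addr0 //.
by move=> y /negPf yg; rewrite gr_deltaE yg mul0r.
Qed.

Lemma gr_deltaM (g h : gT) : delta g * delta h = delta (g * h)%g :> RG.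
Proof.
apply: gr_ext => x; rewrite gr_delta_mulE !gr_deltaE.
by rewrite -(inj_eq (mulgI g)) mulKVg.
Qed.

Lemma gr_deltaX (g : gT) n : delta g ^+ n = delta (g ^+ n)%g :> RG.
Proof.
by elim: n => [|n IHn]; rewrite ?expr0 ?gr_delta1 // exprS IHn gr_deltaM -expgS.
Qed.

Lemma gr_sumE I (s : seq I) (F : I -> RG) x :
  gr_fun (\sum_(i <- s) F i) x = \sum_(i <- s) gr_fun (F i) x.
Proof.
elim: s => [|i s IHs]; first by rewrite !big_nil /gr_fun ffunE.
by rewrite !big_cons gr_addE IHs.
Qed.

Lemma gr_sum_delta (u : RG) : u = \sum_g const (gr_fun u g) * delta g.
Proof.
apply: gr_ext => x; rewrite gr_sumE (bigD1 x) //= [X in X + _]gr_const_mulE.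
rewrite gr_deltaE eqxx mulr1 big1 ?addr0 // => g /negPf gx.
by rewrite [LHS]gr_const_mulE gr_deltaE eq_sym gx mulr0.
Qed.

Lemma gr_const0 : const 0 = 0 :> RG.
Proof. by apply: gr_ext => x; rewrite gr_constE mul0rn /gr_fun ffunE. Qed.

Lemma gr_const_sum I (s : seq I) (F : I -> R) :
  const (\sum_(i <- s) F i) = \sum_(i <- s) const (F i) :> RG.
Proof.
elim: s => [|i s IHs]; first by rewrite !big_nil gr_const0.
by rewrite !big_cons gr_constD IHs.
Qed.

Lemma gr_const_nat n : const n%:R = n%:R :> RG.
Proof.
elim: n => [|n IHn]; first exact: gr_const0.
by rewrite !mulrS gr_constD IHn gr_const1.
Qed.

Lemma augmentation0_sum (u : RG) : augmentation u = 0 ->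
  u = \sum_g (delta g - 1) * const (gr_fun u g).
Proof.
move=> u0; under eq_bigr do rewrite mulrBl mul1r -gr_constC.
rewrite sumrB -gr_sum_delta -gr_const_sum -/(augmentation u) u0.
by rewrite gr_const0 subr0.
Qed.

End GroupRingBasics.

(** * Actions of p-groups modulo a subgroup containing the multiples of p *)

Lemma sub1_prime_power (E : nzRingType) (x : E) p : prime p ->
  exists c, (x - 1) ^+ p = x ^+ p - 1 + c *+ p.
Proof.
move=> p_pr; set y := x - 1.
have -> : x = y + 1 by rewrite subrK.
exists (- \sum_(i < p.-1) y ^+ i.+1 *+ ('C(p, i.+1) %/ p)).
rewrite -(prednK (prime_gt0 p_pr)) exprD1n big_ord_recr big_ord_recl /=.
rewrite (prednK (prime_gt0 p_pr)) bin0 binn !mulr1n expr0.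
rewrite mulNrn -sumrMnl [X in _ - X](eq_bigr (fun i : 'I_p.-1 => y ^+ i.+1 *+
  'C(p, i.+1))).
  by rewrite [1 + _ + _]addrC addrA [_ + _ - 1]addrAC !addrK.
move=> i _; rewrite -mulrnA divnK // prime_dvd_bin //=.
by rewrite -[X in (_ < X)%N](prednK (prime_gt0 p_pr)) ltnS ltn_ord.
Qed.

(** The inductive step for p-groups: H = K<h> with [K] normal of index [p]. The last clause is the
    induction principle along this factorization. *)
Lemma pgroup_index_prime (gT : finGroupType) p (H : {group gT}) :
  prime p -> (p.-group H)%g -> (1 < #|H|)%N ->
  exists (K : {group gT}) h, [/\ (K <| H)%g, (#|K| < #|H|)%N, h \in H,
    (h ^+ p)%g \in K
    & forall S : gT -> Prop, S 1%g -> (forall k, k \in K -> S k) -> S h ->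
      (forall x y, x \in H -> y \in H -> S x -> S y -> S (x * y)%g) ->
      forall x, x \in H -> S x].
Proof.
move=> p_pr pH H1; have oH := card_pgroup pH.
have e0 : (0 < logn p #|H|)%N.
  by rewrite lt0n; apply: contraTneq H1 => e0; rewrite oH e0.
have [K [_ nKH oK]] := normal_pgroup pH (normal_refl H) (leq_pred (logn p
  #|H|)).
have KH := normal_sub nKH.
have iK : #|H : K|%g = p.
  apply/eqP; rewrite -(eqn_pmul2l (cardG_gt0 K)) Lagrange // oK {1}oH.
  by rewrite -expnSr prednK.
have ltKH : (#|K| < #|H|)%N.
  by rewrite oK {2}oH ltn_exp2l ?prime_gt1 // prednK.
have maxK : maximal K H by apply: p_index_maximal KH _; rewrite iK.
have /properP [_ [h hH hK]] := maxgroupp maxK.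
have nKh : h \in 'N(K)%g by apply: subsetP hH; exact: normal_norm.
exists K, h; split=> //.
  rewrite coset_idr ?groupX // morphX //.
  by rewrite -iK -card_quotient ?normal_norm // expg_cardG // mem_quotient.
move=> S S1 SK Sh SM x; rewrite -(mulg_normal_maximal nKH maxK (H := <[h]>)).
- case/mulsgP => k _ kK /cycleP [n ->] ->.
  have hX : (h ^+ n)%g \in H /\ S (h ^+ n)%g.
    elim: n => [|n [hnH Shn]]; first by rewrite expg0 group1.
    by rewrite expgS groupM //; split=> //; exact: SM.
  by case: hX => hnH Shn; apply: SM => //; [exact: (subsetP KH) | exact: SK].
- by rewrite cycle_subG.
- by rewrite cycle_subG.
Qed.
Section PGroupAction.
Variables (R : comNzRingType) (gT : finGroupType) (V : lmodType (groupRing R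
  gT)).
Variables (p : nat) (p_pr : prime p).
Local Notation RG := (groupRing R gT).
Local Notation delta := (gr_delta R).
Implicit Types (U Y : V -> Prop) (H K : {group gT}).

Definition subgrp U := U 0 /\ forall v w, U v -> U w -> U (v - w).
Definition stable H U := forall (h : gT) v, h \in H -> U v -> U (delta h *: v).

Lemma subgrpD U v w : subgrp U -> U v -> U w -> U (v + w).
Proof.
move=> [U0 UB] vU wU; rewrite -[w]opprK; apply: (UB) => //.
by rewrite -sub0r; exact: UB.
Qed.

Lemma deltaZM (g h : gT) (v : V) : delta (g * h)%g *: v = delta g *: (delta h
  *: v).
Proof. by rewrite scalerA gr_deltaM. Qed.

Lemma deltaZ1 (v : V) : delta (1%g : gT) *: v = v.
Proof. by rewrite gr_delta1 scale1r. Qed.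

Lemma sub1_power_mem U (h : gT) v : subgrp U -> (forall v, U (v *+ p)) ->
  U (delta (h ^+ p)%g *: v - v) -> U ((delta h - 1) ^+ p *: v).
Proof.
move=> Usub Up Uh; have [c ->] := sub1_prime_power (delta h : RG) p_pr.
rewrite scalerDl scalerBl scale1r gr_deltaX -scalerMnl.
by apply: subgrpD.
Qed.

Lemma sub1_powerS (h : gT) (v : V) n :
  (delta h - 1) ^+ n.+1 *: v = (delta h - 1) ^+ n *: (delta h *: v - v).
Proof. by rewrite exprSr -scalerA scalerBl scale1r. Qed.

(* The last hypothesis says that U and I V together generate V, where I is the *)
(* augmentation ideal of H.                                                    *)
Lemma pgroup_nakayama H U : (p.-group H)%g -> subgrp U -> stable H U ->
  (forall v, U (v *+ p)) ->
  (forall Y, subgrp Y -> (forall v, U v -> Y v) ->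
     (forall (h : gT) v, h \in H -> Y (delta h *: v - v)) -> forall v, Y v) ->
  forall v, U v.
Proof.
have [m] := ubnP #|H|; elim: m => // m IHm in H U *.
rewrite ltnS => leHm pH Usub Ust Up gen.
have [H1 | H1] := leqP #|H| 1.
  apply: gen => // h v; have -> : H :=: 1%g by apply/card_le1_trivg.
  by rewrite inE => /eqP ->; rewrite deltaZ1 subrr; case: Usub.
have [K [h [nKH ltKH hH hpK genH]]] := pgroup_index_prime p_pr pH H1.
have KH := normal_sub nKH.
apply: (IHm K); [exact: leq_trans ltKH leHm | exact: pgroupS KH pH | by [] | |
  by [] |].
  by move=> k v kK; apply: Ust; exact: subsetP kK.
move=> Y0 Y0sub UY0 Y0K.
(* [W] is U + I_K V, as an intersection of subgroups, where I_K is the augmentation ideal of [K]; it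
   is stable under [H] because [K] is normal. *)
pose W v := forall Y, subgrp Y -> (forall v, U v -> Y v) ->
  (forall (k : gT) v, k \in K -> Y (delta k *: v - v)) -> Y v.
suff WV : forall v, W v by move=> v; apply: WV.
have UW u : U u -> W u by move=> uU Y _ UY _; exact: UY.
have Wsub : subgrp W.
  split=> [|u w uW wW] Y Ysub UY YK; first by case: Ysub.
  by apply: (Ysub.2); [exact: uW | exact: wW].
have WK k u : k \in K -> W (delta k *: u - u) by move=> kK Y _ _; apply.
have Wst : stable H W.
  move=> g w gH wW Y Ysub UY YK.
  apply: (wW (fun v => Y (delta g *: v))).
  - split=> [|a b aY bY]; first by rewrite scaler0; case: Ysub.
    by rewrite scalerBr; apply: (Ysub.2).
  - by move=> u uU; apply: UY; exact: Ust.
  - move=> k u kK; have := YK (k ^ g^-1)%g (delta g *: u).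
    rewrite memJ_norm; last first.
      by rewrite groupV; apply: subsetP gH; exact: normal_norm.
    by rewrite scalerBr -!deltaZM conjgE invgK mulgA mulgVK => /(_ kK).
have WhV a : exists w v', W w /\ a = w + (delta h *: v' - v').
  move: a; apply: gen.
  - split=> [|a b [w [v [wW ->]]] [w' [v' [w'W ->]]]].
      by exists 0, 0; rewrite scaler0 subrr addr0; split=> //; case: Wsub.
    exists (w - w'), (v - v'); split; first by apply: (Wsub.2).
    by rewrite scalerBr opprD addrACA; congr (_ + _);
      rewrite !opprB addrACA [RHS]addrACA [- v + _]addrC.
  - by move=> u uU; exists u, 0; rewrite scaler0 subrr addr0; split=> //;
    exact: UW.
  - move=> g u gH; move: g gH u.
    pose S g := forall u, exists w v', W w /\ delta g *: u - u = w + (delta h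
      *: v' - v').
    apply: (genH S).
    + move=> u; exists 0, 0; rewrite deltaZ1 !subrr scaler0 subrr addr0.
      by split=> //; case: Wsub.
    + move=> k kK u; exists (delta k *: u - u), 0.
      by rewrite scaler0 subrr addr0; split=> //; exact: WK.
    + by move=> u; exists 0, u; rewrite add0r; split=> //; case: Wsub.
    move=> x y xH yH Sx Sy u.
    have [w [v [wW wE]]] := Sx (delta y *: u); have [w' [v' [w'W w'E]]] := Sy u.
    exists (w + w'), (v + v'); split; first exact: (subgrpD Wsub).
    rewrite deltaZM -(subrK (delta y *: u) (delta x *: _)) -addrA wE w'E.
    by rewrite scalerDr opprD addrACA; congr (_ + _); rewrite addrACA.
have Wpow n a : exists w v', W w /\ a = w + (delta h - 1) ^+ n *: v'.
  elim: n => [|n [w [v' [wW vE]]]].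
    by exists 0, a; rewrite expr0 scale1r add0r; split=> //; case: Wsub.
  have [w' [v'' [w'W v'E]]] := WhV v'.
  exists (w + (delta h - 1) ^+ n *: w'), v''; split.
    apply: (subgrpD Wsub) => //; elim: n {vE} w' w'W {v'E} => [|k IHk] w' w'W.
      by rewrite expr0 scale1r.
    by rewrite sub1_powerS; apply: IHk; apply: (Wsub.2) => //; exact: Wst.
  by rewrite vE {1}v'E scalerDr addrA sub1_powerS.
(* Iterating V = W + (h - 1) V leaves (h - 1)^p V, which lies in [W]: modulo [p] it is (h^p - 1) V,
   and h^p is in [K]. *)
move=> v; have [w [v' [wW ->]]] := Wpow p v.
apply: (subgrpD Wsub) => //; apply: (@sub1_power_mem W) => //; last exact: WK.
by move=> u; exact: UW.
Qed.

(** A p-group has nonzero fixed vectors in a nonzero module killed by [p]. The multiplier [c] keeps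
    the fixed vector in the cyclic module generated by [v]. *)
Lemma pgroup_fixed H U v : (p.-group H)%g -> subgrp U -> stable H U ->
  (forall v, U (v *+ p)) -> ~ U v ->
  exists c : RG, ~ U (c *: v) /\
    forall h : gT, h \in H -> U (delta h *: (c *: v) - c *: v).
Proof.
have [m] := ubnP #|H|; elim: m => // m IHm in H *.
rewrite ltnS => leHm pH Usub Ust Up vU.
have [H1 | H1] := leqP #|H| 1.
  exists 1; rewrite scale1r; split=> // h.
  have -> : H :=: 1%g by apply/card_le1_trivg.
  by rewrite inE => /eqP ->; rewrite deltaZ1 subrr; case: Usub.
have [K [h [nKH ltKH hH hpK genH]]] := pgroup_index_prime p_pr pH H1.
have KH := normal_sub nKH.
have [|||c [cU cK]] := IHm K _ _ Usub _ Up vU.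
- exact: leq_trans ltKH leHm.
- exact: pgroupS KH pH.
- by move=> k u kK; apply: Ust; exact: subsetP kK.
pose f j := (delta h - 1) ^+ j * c.
have fS j : f j.+1 *: v = delta h *: (f j *: v) - f j *: v.
  by rewrite /f exprS -mulrA -[LHS]scalerA scalerBl scale1r.
have fK j k : k \in K -> U (delta k *: (f j *: v) - f j *: v).
  elim: j k => [|j IHj] k kK; first by rewrite /f expr0 mul1r; exact: cK.
  have kJ : (k ^ h)%g \in K.
    by rewrite memJ_norm //; apply: subsetP hH; exact: normal_norm.
  (* Since k h = h k^h, one has (k - 1)(h - 1) = h (k^h - 1) - (k - 1). *)
  have := Usub.2 _ _ (Ust _ _ hH (IHj _ kJ)) (IHj _ kK).
  rewrite fS !scalerBr -!deltaZM -conjgC !opprB -!addrA.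
  by rewrite (addrCA (- (delta h *: _))) (addrC (- (delta h *: _))) (addrCA (-
    (delta k *: _))).
have fp : U (f p *: v).
  rewrite /f -scalerA; apply: sub1_power_mem => //; exact: cK.
(* The last power of h - 1 that does not send c v into [U] gives a vector fixed modulo [U] by [h],
   and still by [K]. *)
have exj : exists j, `[< U (f j *: v) >] by exists p; apply/asboolP.
case: (ex_minnP exj) => -[|j] /asboolP fj jmin.
  by case: cU; move: fj; rewrite /f expr0 mul1r.
have fjU : ~ U (f j *: v).
  by move=> /asboolT /jmin; rewrite ltnn.
exists (f j); split=> //.
apply: genH => [|k kK||x y xH yH Sx Sy].
- by rewrite deltaZ1 subrr; case: Usub.
- exact: fK.
- by rewrite -fS.
- rewrite deltaZM -[_ - _](subrKA (delta x *: (f j *: v))) -scalerBr.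
  by apply: (subgrpD Usub) => //; apply: Ust.
Qed.

End PGroupAction.

(** * Dimension of vector spaces through finite bases *)

Section Dimension.
Variables (F : fieldType) (W : lmodType F).

Lemma finite_basis (J : finType) (y : J -> W) :
  spanning y -> exists r (x : 'I_r -> W), basis x.
Proof.
move=> ysp; have exr : exists r, `[< exists x : 'I_r -> W, spanning x >].
  exists #|J|; apply/asboolP; exists (fun k => y (enum_val k)) => w.
  have [u ->] := ysp w; exists (fun k => u (enum_val k)).
  by rewrite /lincomb sum_enum_val.
case: (ex_minnP exr) => r /asboolP [x xsp] rmin; exists r, x;
  split=> // u xu0 i.
apply: contrapT => /eqP ui0; case: r => [|r] in x xsp rmin u xu0 i ui0 *.
  by case: i ui0.
suff /asboolT /rmin : exists x' : 'I_r -> W, spanning x' by rewrite ltnn.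
exists (fun j => x (lift i j)) => w; have [c ->] := xsp w.
exists (fun j => c (lift i j) - c i / u i * u (lift i j)).
have -> : lincomb x c = lincomb x (fun j => c j - c i / u i * u j).
  by rewrite lincombB lincombZ xu0 scaler0 subr0.
by rewrite {1}/lincomb (bigD1_ord i) //= divfK // subrr scale0r add0r.
Qed.

Lemma has_dimension_basis r :
  has_dimension W r <-> exists x : 'I_r -> W, basis x.
Proof.
split=> [[f [g fK gK]] | [x [xsp xfree]]].
  pose x i := g (delta_mx 0 i); exists x.
  have fx u : f (lincomb x u) = \row_i u i.
    rewrite linear_sum [RHS]row_sum_delta; apply: eq_bigr => i _.
    by rewrite linearZ /= gK mxE.
  split=> [w | u xu0 i].
    exists (f w 0); apply: (can_inj fK); rewrite fx.
    by apply/rowP => i; rewrite mxE.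
  by have /rowP /(_ i) := fx u; rewrite xu0 linear0 !mxE.
pose c w := projT1 (cid (xsp w)).
have cE w : w = lincomb x (c w) by rewrite /c; case: cid.
pose f w : 'rV[F]_r := \row_i c w i.
have flin : linear f.
  move=> a v w; apply/rowP => i; rewrite !mxE.
  move: i; apply: (independent_inj xfree).
  by rewrite lincombD lincombZ -!cE.
pose fL := GRing.isLinear.Build F W 'rV[F]_r _ f flin.
pose f' : {linear W -> 'rV[F]_r} := HB.pack f fL.
exists f', (fun v : 'rV[F]_r => lincomb x (fun i => v 0 i)) => [w | v].
  by rewrite [RHS]cE; congr lincomb; apply/funext => i; rewrite mxE.
apply/rowP => i; rewrite mxE; move: i; apply: (independent_inj xfree).
by rewrite -cE.
Qed.

Lemma basis_card r s (x : 'I_r -> W) (y : 'I_s -> W) :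
  basis x -> basis y -> r = s.
Proof.
move=> xb yb; apply/eqP; rewrite eqn_leq.
move: (basis_le_spanning xb yb.1) (basis_le_spanning yb xb.1).
by rewrite !card_ord => -> ->.
Qed.

Lemma dimension_basis r (x : 'I_r -> W) : basis x -> dimension W = r.
Proof.
move=> xb; rewrite /dimension;
  case: classical_sets.xgetP => [n _ /has_dimension_basis [y yb]|].
  exact: basis_card yb xb.
by move=> /(_ r); case; apply/has_dimension_basis; exists x.
Qed.

End Dimension.

(** * Restriction of scalars to [R] and translates of a family *)

Section Restriction.
Variables (R : comNzRingType) (gT : finGroupType) (V : lmodType (groupRing R
  gT)).
Local Notation const := (gr_const gT).

Definition restriction : Type := V.
HB.instance Definition _ := GRing.Zmodule.on restriction.

Definition restriction_scale (a : R) (v : restriction) : restriction :=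
  const a *: (v : V).

Fact restriction_scaleA a b v :
  restriction_scale a (restriction_scale b v) = restriction_scale (a * b) v.
Proof. by rewrite /restriction_scale scalerA gr_constM. Qed.
Fact restriction_scale1 : left_id 1 restriction_scale.
Proof. by move=> v; rewrite /restriction_scale gr_const1 scale1r. Qed.
Fact restriction_scaleDr : right_distributive restriction_scale +%R.
Proof. by move=> a v w; rewrite /restriction_scale scalerDr. Qed.
Fact restriction_scaleDl v : {morph restriction_scale^~ v : a b / a + b}.
Proof. by move=> a b; rewrite /restriction_scale gr_constD scalerDl. Qed.
HB.instance Definition _ := GRing.Zmodule_isLmodule.Build R restriction
  restriction_scaleA restriction_scale1 restriction_scaleDr restriction_scaleDl.

Lemma restriction_scaleE a (v : V) : a *: (v : restriction) = const a *: v.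
Proof. by []. Qed.

Lemma restriction_scaleC a (u : groupRing R gT) (v : V) :
  u *: (a *: (v : restriction) : V) = a *: (u *: v : restriction) :>
    restriction.
Proof. by rewrite !restriction_scaleE !scalerA gr_constC. Qed.

Lemma lincombR (I : finType) (x : I -> restriction) u (w : groupRing R gT) :
  w *: (lincomb x u : V) = lincomb (fun i => w *: (x i : V) : restriction) u.
Proof.
by rewrite scaler_sumr; apply: eq_bigr => i _; exact: restriction_scaleC.
Qed.

(* The x i form an RG-basis of V exactly when this family is an R-basis.       *)
Definition translates (I : finType) (x : I -> V) (gi : gT * I) : restriction :=
  gr_delta R gi.1 *: x gi.2.

Lemma sum_translates (I : finType) (x : I -> V) (c : I -> groupRing R gT) :
  \sum_i c i *: x i = lincomb (translates x) (fun gi => gr_fun (c gi.2) gi.1).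
Proof.
rewrite /lincomb -(pair_bigA _ (fun g i => gr_fun (c i) g *: translates x (g,
  i))).
rewrite exchange_big; apply: eq_bigr => i _ /=.
rewrite {1}(gr_sum_delta (c i)) scaler_suml; apply: eq_bigr => g _.
by rewrite restriction_scaleE /translates scalerA.
Qed.

End Restriction.

(** * Lifting a basis of V / (pi V + [V, G]) *)

Section TopGenerators.
Variables (R : comNzRingType) (pi : uniformizer R) (gT : finGroupType).
Variable (V : lmodType (groupRing R gT)).
Local Notation const := (gr_const gT).
Local Notation VR := (restriction V).

Lemma top_class_sum I (s : seq I) (F : I -> V) :
  top_class pi (\sum_(i <- s) F i) = \sum_(i <- s) top_class pi (F i).
Proof.
elim: s => [|i s IHs]; last by rewrite !big_cons top_classD IHs.
rewrite !big_nil; apply: (addrI (top_class pi 0)).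
by rewrite -top_classD !addr0.
Qed.

Lemma top_class_lincomb (I : finType) (x : I -> VR) u :
  top_class pi (lincomb x u : V) =
  \sum_i residue pi (u i) *: top_class pi (x i : V).
Proof.
rewrite top_class_sum; apply: eq_bigr => i _.
by rewrite restriction_scaleE -top_scaleE.
Qed.

(** Finite generation ensures that [rR] is a genuine dimension and not the default value 0; the
    [x i] lift a basis of the top quotient. *)
Lemma top_generators (J : finType) (y : J -> VR) : spanning y ->
  exists x : 'I_(rR pi V) -> V,
    (forall v : V, exists u,
       v - (lincomb (x : _ -> VR) u : V) \in @top_submod R pi gT V) /\
    (forall u, (lincomb (x : _ -> VR) u : V) \in @top_submod R pi gT V ->
       forall i, exists t, u i = unif pi * t).
Proof.
move=> ysp; have [|r [z zb]] := @finite_basis _ (topQuotient pi V) J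
    (fun j => top_class pi (y j : V)).
  move=> w; have [u uE] := ysp (top_lift w); exists (fun j => residue pi (u j)).
  by rewrite -[LHS]top_liftK uE top_class_lincomb.
have -> : rR pi V = r by exact: dimension_basis zb.
pose x i : V := top_lift (z i); exists x; split=> [v | u /= xu i].
  have [c cE] := zb.1 (top_class pi v); exists (fun i => residue_lift (c i)).
  apply/top_class_eq; rewrite top_class_lincomb cE.
  by apply: eq_bigr => i _; rewrite residue_liftK top_liftK.
apply/residue_eq0; apply: (zb.2 (fun i => residue pi (u i))).
rewrite -[X in X \in _]subr0 in xu; have := (top_class_eq pi _ _).2 xu.
rewrite top_class_lincomb (_ : top_class pi (0 : V) = 0) => [<-|].
  by apply: eq_bigr => k _; rewrite top_liftK.
by have := top_class_sum [::] (fun i : 'I_0 => 0); rewrite !big_nil.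
Qed.

End TopGenerators.

(** * Generators over the group ring of a p-group *)

Section PGroupGenerators.
Variables (R : comNzRingType) (pi : uniformizer R) (gT : finGroupType) (p :
  nat).
Hypotheses (p_pr : prime p) (pG : (p.-group [set: gT])%g).
Hypothesis pR : exists t, p%:R = unif pi * t.
Variable V : lmodType (groupRing R gT).
Local Notation RG := (groupRing R gT).
Local Notation const := (gr_const gT).
Local Notation VR := (restriction V).
Local Notation top := (@top_submod R pi gT V).

Definition gr_norm : RG := \sum_g gr_delta R g.

Lemma subgrp_sum (Y : V -> Prop) I (s : seq I) (F : I -> V) :
  subgrp Y -> (forall i, Y (F i)) -> Y (\sum_(i <- s) F i).
Proof.
move=> Ysub YF; elim: s => [|i s IHs]; first by rewrite big_nil; case: Ysub.
by rewrite big_cons; apply: subgrpD.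
Qed.

(** Let [U] be the [RG]-span of the [x i]. As pi divides [p], U + pi V contains p V, so
    [pgroup_nakayama] removes [V, G] from U + pi V + [V, G] = V; [nakayama] then removes pi V. *)
Lemma translates_spanning (J : finType) (y : J -> VR) r (x : 'I_r -> V) :
  spanning y -> (forall v : V, exists u, v - (lincomb (x : _ -> VR) u : V) \in
    top) ->
  spanning (translates x).
Proof.
move=> ysp xtop.
pose U (v : V) := exists c : 'I_r -> RG, v = \sum_i c i *: x i.
suff UV : forall v, U v by move=> v; have [c ->] := UV v;
  rewrite sum_translates; eexists.
have UZD (a : RG) (v w : V) : U v -> U w -> U (a *: v + w).
  move=> [c ->] [d ->]; exists (fun i => a * c i + d i).
  rewrite scaler_sumr -big_split; apply: eq_bigr => i _.
  by rewrite scalerDl scalerA.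
have U0 : U 0.
  by exists (fun=> 0); rewrite big1 // => i _; rewrite scale0r.
apply: (@nakayama _ pi VR J y U ysp U0) => [a v w|]; first exact: UZD.
have [t pt] := pR.
apply: (@pgroup_nakayama _ _ V p p_pr [set: gT]%G
  (fun w => exists v w', U v /\ w = v + unif pi *: (w' : VR) :> VR)) => //.
- split=> [|v w [v1 [v2 [v1U ->]]] [w1 [w2 [w1U ->]]]].
    by exists 0, 0; rewrite scaler0 addr0.
  exists (v1 - w1), (v2 - w2); split.
    by have := UZD (- 1) _ _ w1U v1U; rewrite scaleN1r addrC.
  by rewrite scalerBr opprD addrACA.
- move=> h v _ [v1 [v2 [v1U ->]]].
  exists (gr_delta R h *: v1), (gr_delta R h *: v2); split.
    by have := UZD (gr_delta R h) _ _ v1U U0; rewrite addr0.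
  by rewrite scalerDr -restriction_scaleC.
- move=> v; exists 0, (t *: (v : VR)); split=> //.
  by rewrite add0r scalerA -pt restriction_scaleE gr_const_nat scaler_nat.
move=> Y Ysub UY YG v;
have [u] := xtop v;
  set w := lincomb _ u => /asboolP [b [c [[m [a [d [a0 ->]]]]]]].
move=> /(canRL (subrK _)) ->; apply: (subgrpD Ysub); last first.
  apply: UY; exists w, 0; rewrite scaler0 addr0; split=> //.
  by exists (fun i => const (u i)).
apply: (subgrpD Ysub).
  by apply: UY; exists 0, b; rewrite add0r.
apply: subgrp_sum => // i; rewrite (augmentation0_sum (a0 i)) scaler_suml.
apply: subgrp_sum => // g; rewrite -scalerA scalerBl scale1r.
by apply: YG; rewrite inE.
Qed.

(** A relation modulo pi with a coefficient not divisible by pi has an [RG]-multiple of the same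
    kind that is fixed by G modulo pi. Its coefficients are then norm multiples, so the first
    hypothesis yields a relation among the [x i] in the top quotient, where they are independent. *)
Lemma translates_residually_independent r (x : 'I_r -> V) :
  (forall v b : V, gr_norm *: v = const (unif pi) *: b -> v \in top) ->
  (forall u, (lincomb (x : _ -> VR) u : V) \in top ->
     forall i, exists t, u i = unif pi * t) ->
  residually_independent pi (translates x).
Proof.
move=> norm_top xfree u w uw; have [t pt] := pR.
pose U (m : 'rV[RG]_r) := forall i g, exists t, gr_fun (m 0 i) g = unif pi * t.
pose F (m : 'rV[RG]_r) : V := \sum_i m 0 i *: x i.
pose m : 'rV[RG]_r := \row_i [ffun g => u (g, i)].
have mE i g : gr_fun (m 0 i) g = u (g, i) by rewrite mxE /gr_fun ffunE.
suff mU : U m by move=> [g i]; rewrite -mE.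
have Fm : F m = const (unif pi) *: (w : V).
  rewrite /F sum_translates -restriction_scaleE -uw.
  by apply: (congr1 (lincomb (translates x))); apply/funext => -[g i];
    rewrite mE.
apply: contrapT => mU.
have [|||c [cU cfix]] := pgroup_fixed p_pr pG _ _ _ mU.
- split=> [i g | a b aU bU i g].
    by exists 0; rewrite mxE /gr_fun ffunE mulr0.
  have [[s sE] [s' s'E]] := (aU i g, bU i g); exists (s - s').
  by rewrite !mxE /gr_fun !ffunE -!/(gr_fun _ _) sE s'E mulrBr.
- move=> h a _ aU i g; rewrite mxE gr_delta_mulE; exact: aU.
- move=> a i g; exists (t * gr_fun (a 0 i) g).
  rewrite mulrA -pt mulr_natl -scaler_nat mxE -gr_const_nat.
  by rewrite [LHS]gr_const_mulE mulr_natl.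
have Fz : F (c *: m) = const (unif pi) *: (c *: (w : V)).
  rewrite scalerA gr_constC -scalerA -Fm /F scaler_sumr.
  by apply: eq_bigr => k _; rewrite mxE scalerA.
move: (c *: m) Fz cU cfix => z Fz zU zfix; apply: zU => i g.
pose d i := gr_fun (z 0 i) 1%g.
have eP k h : exists e, gr_fun (z 0 k) h = d k + unif pi * e.
  have [|e] := zfix h _ k h; first by rewrite inE.
  rewrite mxE [(gr_delta R h *: z) 0 k]mxE gr_addE gr_delta_mulE mulVg -/(d k)
    mxE => eE.
  exists (- e); rewrite mulrN -eE opprD addNKr.
  by rewrite /gr_fun !ffunE opprK.
pose e k : RG := [ffun h => projT1 (cid (eP k h))].
(* An element of [RG] fixed modulo pi has constant coefficients modulo pi; [d k] is its coefficient
   at 1. *)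
have zE k : z 0 k = gr_norm * const (d k) + const (unif pi) * e k.
  apply: gr_ext => h; rewrite gr_addE [gr_fun (_ * e k) h]gr_const_mulE.
  rewrite [gr_fun (gr_norm * _) h]gr_mul_constE gr_sumE (bigD1 h) //=.
  rewrite gr_deltaE eqxx big1 ?addr0 ?mul1r => [|l /negPf lh]; last first.
    by rewrite gr_deltaE eq_sym lh.
  by rewrite /e {2}/gr_fun ffunE; case: cid.
have dt : forall k, exists t, d k = unif pi * t.
  apply: xfree; apply: (norm_top _ (c *: (w : V) - \sum_k e k *: x k)).
  rewrite scalerBr -Fz /F.
  apply/eqP; rewrite eq_sym subr_eq; apply/eqP.
  rewrite !scaler_sumr -big_split; apply: eq_bigr => k _.
  by rewrite zE scalerDl restriction_scaleE !scalerA.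
have [[s sE] [s' s'E]] := (dt i, eP i g).
by exists (s + s'); rewrite s'E sE mulrDr.
Qed.

Lemma rR_eq_of_norm n (y : gT * 'I_n -> VR) : basis y ->
  (forall v b : V, gr_norm *: v = const (unif pi) *: b -> v \in top) ->
  rR pi V = n.
Proof.
move=> yb norm_top; have [x [xsp xfree]] := top_generators pi yb.1.
have xr := translates_residually_independent norm_top xfree.
have := residually_independent_le yb.1 xr.
have := basis_le_spanning yb (translates_spanning yb.1 xsp).
rewrite !card_prod !card_ord.
have oG : (0 < #|gT|)%N by apply/card_gt0P; exists 1%g.
rewrite (leq_pmul2l oG) (leq_pmul2l oG) => nr rn.
by apply/eqP; rewrite eqn_leq nr rn.
Qed.

Lemma group_ring_basis_of_rR n (y : gT * 'I_n -> VR) : basis y ->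
  rR pi V = n -> exists x : 'I_n -> V, basis (translates x).
Proof.
move=> yb rn; have [x [xsp _]] := top_generators pi yb.1; move: x xsp.
rewrite rn => x xsp; exists x; apply: (spanning_basis yb).
exact: translates_spanning yb.1 xsp.
Qed.

End PGroupGenerators.

(** * Cohomology of modules over the group ring *)

Lemma insert0_tuple (H : finGroupType) n h (x : n.+1.-tuple H) :
  tuple_insert ord0 h x = cons_tuple h x.
Proof.
by rewrite -[RHS](insert_face ord0) tnth0 face0_cons.
Qed.

Lemma insert1_tuple (H : finGroupType) (h a : H) :
  tuple_insert (lift ord0 ord0) h [tuple a] = cons_tuple a [tuple h].
Proof.
rewrite -[RHS](insert_face (lift ord0 ord0)); congr tuple_insert.
by apply: eq_from_tnth => -[[|//] lti]; rewrite tnth_mktuple !(tnth_nth h).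
Qed.

Section GroupRingModules.
Variables (R : comNzRingType) (gT : finGroupType) (V : lmodType (groupRing R
  gT)).
Local Notation RG := (groupRing R gT).
Local Notation const := (gr_const gT).
Local Notation delta := (gr_delta R).
Local Notation VR := (restriction V).

Definition subg_act (S : {group gT}) (s : subg_of S) : {additive V -> V} :=
  *:%R (delta (sgval s)).

Lemma subg_actM (S : {group gT}) (s t : subg_of S) v :
  subg_act (s * t)%g v = subg_act s (subg_act t v).
Proof. exact: deltaZM. Qed.

Lemma subg_actK (S : {group gT}) (s : subg_of S) v :
  subg_act s (subg_act s^-1%g v) = v.
Proof. by rewrite -subg_actM mulgV; exact: deltaZ1. Qed.

Lemma delta_lincomb_translates (I : finType) (x : I -> V) (h : gT) u :
  delta h *: (lincomb (translates x) u : V) =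
  lincomb (translates x) (fun gi => u (h^-1 * gi.1, gi.2)%g) :> VR.
Proof.
rewrite lincombR /lincomb.
rewrite [RHS](reindex (fun gi => (h * gi.1, gi.2)%g)) /=; last first.
  exists (fun gi => (h^-1 * gi.1, gi.2)%g) => -[g i] _ /=.
    by rewrite mulKg.
  by rewrite mulKVg.
by apply: eq_bigr => -[g i] _ /=; rewrite mulKg /translates /= deltaZM.
Qed.

(** Let T be the set of chosen representatives of the right cosets of [S]. The map [P] keeps the
    coefficients at T; its conjugate by s keeps those at s T, and the sets s T partition G, so the
    conjugates add up to the identity. *)
Lemma translates_cohomologically_trivial (I : finType) (x : I -> V) :
  basis (translates x) -> cohomologically_trivial V.
Proof.
move=> [xsp xfree] S n.
pose T (g : gT) := repr (S :* g)%g == g.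
pose c (v : V) := projT1 (cid (xsp v)).
have cE v : v = lincomb (translates x) (c v) by rewrite /c; case: cid.
pose P (v : V) : V := lincomb (translates x) (fun gi => c v gi *+ T gi.1).
have PE u : P (lincomb (translates x) u) =
    lincomb (translates x) (fun gi => u gi *+ T gi.1).
  rewrite /P; apply: (congr1 (lincomb (translates x))); apply/funext => gi;
    congr (_ *+ _).
  by move: gi; apply: (independent_inj xfree); rewrite -cE.
have Padd : zmod_morphism P.
  move=> v w; rewrite {1}[v]cE {1}[w]cE -[_ - _]lincombB PE.
  rewrite -[RHS]lincombB; apply: (congr1 (lincomb (translates x)));
    apply/funext => gi.
  by rewrite mulrnBl.
pose P' : {additive V -> V} := HB.pack P (GRing.isZmodMorphism.Build V V P
  Padd).
apply: (@weakly_projective_tate _ V (@subg_act S) P') => [|v];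
  first exact: subg_actM.
rewrite [RHS]cE {1}[v]cE; move: (c v) => u.
have actP s : subg_act s (P' (subg_act s^-1%g (lincomb (translates x) u))) =
    lincomb (translates x) (fun gi => u gi *+ T ((sgval s)^-1 * gi.1)%g).
  rewrite [subg_act s^-1%g _]delta_lincomb_translates [P' _]PE.
  rewrite [LHS]delta_lincomb_translates.
  by apply: (congr1 (lincomb (translates x))); apply/funext => -[g i] /=;
    rewrite invgK mulKVg.
under eq_bigr do rewrite actP.
rewrite /lincomb exchange_big; apply: eq_bigr => -[g i] _ /=.
rewrite -scaler_suml; congr (_ *: _).
have gr : (g * (repr (S :* g))^-1)%g \in S.
  by have /rcosetP [s sS ->] := mem_repr_rcoset S g;
    rewrite invMg mulKVg groupV.
rewrite (bigD1 (subg S (g * (repr (S :* g))^-1)%g)) //= subgK //.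
have Ts (s : gT) : s \in S -> T (s^-1 * g)%g = (repr (S :* g) == s^-1 * g)%g.
  by move=> sS; rewrite /T rcosetM (rcoset_id (groupVr sS)).
rewrite Ts // invMg invgK mulgVK eqxx big1 ?addr0 // => s /eqP sN.
rewrite (Ts _ (subgP s)); case: eqP => [rE | _];
  last by rewrite mulr0n gr_const0.
case: sN; by apply: val_inj; rewrite /= subgK // rE invMg invgK mulKVg.
Qed.

Lemma free_translates : free_of_finite_rank V ->
  exists n (x : 'I_n -> V), basis (translates x).
Proof.
move=> [n [f [f' fK f'K]]]; exists n, (fun i => f (delta_mx 0 i)).
have fE (c : 'I_n -> RG) :
    f (\row_i c i) = \sum_i c i *: f (delta_mx 0 i).
  rewrite [\row_i _]row_sum_delta linear_sum; apply: eq_bigr => i _.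
  by rewrite linearZ mxE.
split=> [v | u].
  exists (fun gi => gr_fun (f' v 0 gi.2) gi.1).
  rewrite -(sum_translates _ (fun i => f' v 0 i)) -fE -[LHS]f'K; congr (f _).
  by apply/rowP => i; rewrite mxE.
pose c i : RG := [ffun g => u (g, i)].
rewrite (_ : lincomb _ u = (f (\row_i c i) : VR)) => [f0 [g i]|].
  have /rowP /(_ i) : \row_i c i = 0 by rewrite -[LHS]fK f0 -[RHS]fK linear0.
  by rewrite !mxE => /ffunP /(_ g); rewrite !ffunE.
rewrite fE sum_translates; apply: (congr1 (lincomb (translates _)));
  apply/funext => -[g i].
by rewrite /gr_fun /c ffunE.
Qed.

Lemma gr_norm_setT v :
  \sum_(h : subg_of [set: gT]) subg_act h v = gr_norm R gT *: v.
Proof.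
rewrite scaler_suml (reindex (@sgval _ [set: gT]%G)) //.
exists (subg [set: gT]) => g _; first exact: sgvalK.
by rewrite subgK // inE.
Qed.

Lemma delta_norm (h : gT) : delta h * gr_norm R gT = gr_norm R gT.
Proof.
rewrite mulr_sumr [RHS](reindex_inj (mulgI h)).
by apply: eq_bigr => g _; rewrite gr_deltaM.
Qed.

Lemma augmentation_delta_sub1 (h : gT) : augmentation (delta h - 1 : RG) = 0.
Proof.
have E (g : gT) : augmentation (delta g) = 1 :> R.
  rewrite /augmentation (bigD1 g) //= gr_deltaE eqxx big1 ?addr0 //.
  by move=> k /negPf kg; rewrite gr_deltaE kg.
rewrite -[X in _ - X](gr_delta1 R gT) /augmentation.
under eq_bigr do rewrite gr_addE.
rewrite big_split /= -/(augmentation _) E (eq_bigr (fun g => - gr_fun (delta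
  1%g) g)).
  by rewrite sumrN -/(augmentation _) E subrr.
by move=> g _; rewrite /gr_fun !ffunE.
Qed.

Variable pi : uniformizer R.

(** As pi is regular on [V], [b] is fixed by G; degree 0 makes it a norm of some z. Then v - pi z
    has norm 0, and degree -1 puts it in [V, G]. *)
Lemma norm_top_of_tate (J : finType) (y : J -> VR) :
  (forall a, unif pi * a = 0 -> a = 0) -> basis y ->
  tate_vanishes (@subg_act [set: gT]) (Negz 0) ->
  tate_vanishes (@subg_act [set: gT]) (Posz 0) ->
  forall v b : V, gr_norm R gT *: v = const (unif pi) *: b ->
    v \in @top_submod R pi gT V.
Proof.
move=> preg [ysp yfree] tateN1 tate0 v b vb.
have Vreg (w : V) : const (unif pi) *: w = 0 -> w = 0.
  have [u uE] := ysp w;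
    rewrite -restriction_scaleE {1}uE -lincombZ => /yfree u0.
  rewrite uE [LHS](_ : _ = lincomb y (fun=> 0)).
    by rewrite /lincomb big1 // => j _; rewrite scale0r.
  by apply: (congr1 (lincomb y)); apply/funext => j; apply: preg; exact: u0.
have bfix h : delta h *: b = b.
  apply/eqP; rewrite -subr_eq0; apply/eqP; apply: Vreg.
  by rewrite scalerBr scalerA gr_constC -scalerA -vb scalerA delta_norm subrr.
have [z bz] : exists z, b = gr_norm R gT *: z.
  have [||g [ginv bg]] := tate0 (fun=> b).
  - by move=> h x; rewrite [RHS]bfix.
  - by move=> x; rewrite cobound_const.
  exists (g [tuple 1%g]); rewrite (bg [tuple 1%g]) -gr_norm_setT.
  apply: eq_bigr => h _; rewrite -ginv; congr g.
  by apply: eq_from_tnth => -[[|//] lti];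
    rewrite tnth_mktuple !(tnth_nth 1%g) /= mulg1.
pose v' := v - const (unif pi) *: z.
have nv' : gr_norm R gT *: v' = 0.
  by rewrite scalerBr scalerA -gr_constC -scalerA -bz vb subrr.
(* The invariant 0-cochain whose value at 1 is [v']. *)
have [||g [ginv v'g]] := tateN1 (fun x => subg_act (tnth x ord0) v').
- by move=> h x; rewrite tnth_mktuple subg_actM.
- move=> x; rewrite /tate_norm -[RHS]nv' -gr_norm_setT.
  by apply: eq_bigr => h _; rewrite (tnth_nth 1%g).
have v'E : v' = \sum_(h : subg_of [set: gT])
    (delta (sgval h) - 1) *: g (cons_tuple 1%g [tuple h^-1%g]).
  rewrite -[LHS](deltaZ1 v').
  have := v'g [tuple 1%g]; rewrite (tnth_nth 1%g) /= => ->.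
  rewrite /tate_bound big_ord_recl big_ord1 expr0 expr1 mulr1z mulrN1z.
  (* The boundary at 1 is the sum of the g(h, 1) - g(1, h). With [h] inverted in the second part and
     g(h, 1) = h g(1, h^-1) by invariance, each term becomes (h - 1) g(1, h^-1). *)
  rewrite [X in _ - X](reindex_inj invg_inj) -sumrB; apply: eq_bigr => h _.
  rewrite scalerBl scale1r insert0_tuple insert1_tuple; congr (_ - _).
  rewrite -[RHS]ginv; congr g; apply: eq_from_tnth => -[[|[|//]] lti].
    by rewrite tnth_mktuple !(tnth_nth 1%g) /= mulg1.
  by rewrite tnth_mktuple !(tnth_nth 1%g) /= mulgV.
apply/asboolP; exists z, v'; split; last by rewrite addrC subrK.
exists #|{: subg_of [set: gT]}|,
  (fun k => delta (sgval (enum_val k)) - 1),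
  (fun k => g (cons_tuple 1%g [tuple (enum_val k)^-1%g])); split=> [k|].
  exact: augmentation_delta_sub1.
by rewrite v'E sum_enum_val.
Qed.

End GroupRingModules.

(** * In the ring of integers, pi divides p and is regular *)

Section PadicNonunit.
Variables (p : nat) (p_pr : prime p) (Qp : padicField p) (K : fieldExtType Qp).

Lemma padic_norm_p : padic_norm (p%:R : Qp) = p%:R^-1.
Proof.
by rewrite padic_norm_nat ?prime_gt0 // (pfactorK 1) ?logn_prime ?eqxx ?expr1.
Qed.

Lemma padic_p_neq0 : p%:R != 0 :> Qp.
Proof.
apply/eqP => /padic_norm_eq0 /eqP; rewrite padic_norm_p invr_eq0 pnatr_eq0.
by rewrite -leqn0 leqNgt prime_gt0.
Qed.

Lemma padic_norm_sum n (F : 'I_n -> Qp) (C : rat) :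
  0 <= C -> (forall i, padic_norm (F i) <= C) -> padic_norm (\sum_i F i) <= C.
Proof.
move=> C0 FC; elim/big_ind: _ => [|x y xC yC|i _] //.
  by rewrite (_ : padic_norm 0 = 0) //; apply/padic_norm_eq0.
by apply: le_trans (padic_normD _ _) _; rewrite ge_max xC.
Qed.

Lemma padic_normX (x : Qp) n : padic_norm (x ^+ n) = padic_norm x ^+ n.
Proof.
elim: n => [|n IHn]; first by rewrite !expr0 padic_norm1.
by rewrite !exprS padic_normM IHn.
Qed.

(** In a monic relation of degree n for 1/p the leading term has norm p^n, while the ultrametric
    inequality bounds the sum of the others by p^(n-1). *)
Lemma p_inv_not_integral (q : {poly padic_int Qp}) :
  q \is monic -> ~~ root (map_poly val q) ((p%:R : Qp)^-1).
Proof.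
move=> q_monic; apply/negP; set y : Qp := p%:R^-1.
have yN : padic_norm y = p%:R.
  have := padic_normM (p%:R : Qp) y; rewrite mulfV ?padic_p_neq0 // padic_norm1.
  rewrite padic_norm_p => /esym/(canRL (mulKf _)) -> //.
    by rewrite invrK mulr1.
  by rewrite invr_eq0 pnatr_eq0 -lt0n prime_gt0.
have p0 : 0 < p%:R :> rat by rewrite ltr0n prime_gt0.
have p1 : 1 < p%:R :> rat by rewrite ltr1n prime_gt1.
pose n := (size q).-1.
have sq : size q = n.+1 by rewrite prednK // size_poly_gt0 monic_neq0.
rewrite /root horner_coef size_map_inj_poly ?rmorph0 //; last exact: val_inj.
rewrite sq big_ord_recr /=.
have cE i : (map_poly val q)`_i = val q`_i by rewrite coef_map.
have -> : (map_poly val q)`_n = 1.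
  by rewrite cE; have /monicP := q_monic; rewrite /lead_coef sq /= => ->.
rewrite mul1r addr_eq0 => /eqP yn.
have : padic_norm (y ^+ n) <= p%:R ^+ n / p%:R.
  rewrite -[y ^+ n]opprK -yn -mulN1r padic_normM padic_normN1 mul1r.
  apply: padic_norm_sum => [|i]; first by rewrite divr_ge0 ?exprn_ge0 ?ltW.
  rewrite cE padic_normM padic_normX yN.
  apply: le_trans (ler_piMl _ _) _;
    [by rewrite exprn_ge0 ?ltW | exact: (valP q`_i) |].
  by rewrite ler_pdivlMr // -exprSr ler_weXn2l ?ltW.
by rewrite padic_normX yN ler_pdivlMr // ger_pMr ?exprn_gt0 // leNgt p1.
Qed.

Lemma ringOfIntegers_p_nonunit : ~ exists s : ringOfIntegers K, p%:R * s = 1.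
Proof.
move=> [s ps]; have /asboolP [q q_monic] := valP s.
have pK : p%:R * val s = 1 
    by rewrite -(rmorph_nat (val : {rmorphism ringOfIntegers K -> K})) -rmorphM
      ps rmorph1.
have -> : val s = in_alg K (p%:R^-1).
  apply: (mulfI (x := p%:R)); first by apply: contra_eq_neq pK => ->;
    rewrite mul0r eq_sym oner_neq0.
  rewrite pK -(rmorph_nat (in_alg K)) -rmorphM mulfV ?padic_p_neq0 //.
  by rewrite rmorph1.
have -> : map_poly (@padic_int_in p Qp K) q = map_poly (in_alg K) (map_poly val
  q).
  by rewrite -map_poly_comp.
rewrite /root horner_map fmorph_eq0.
by apply/negP; exact: p_inv_not_integral.
Qed.

Variable pi : uniformizer (ringOfIntegers K).

Lemma unif_dvd_p : exists t, p%:R = unif pi * t.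
Proof. by apply/unifP; exact: ringOfIntegers_p_nonunit. Qed.

Lemma unif_regular x : unif pi * x = 0 -> x = 0.
Proof.
pose v : {rmorphism ringOfIntegers K -> K} := val.
move=> /(congr1 v); rewrite rmorphM rmorph0 => /eqP.
rewrite mulf_eq0 => /orP [/eqP pi0 | /eqP x0]; last first.
  by apply: (val_inj : injective v); rewrite rmorph0.
have [t] := unif_dvd_p => /(congr1 v).
rewrite rmorphM pi0 mul0r rmorph_nat => /eqP.
by rewrite -(rmorph_nat (in_alg K)) fmorph_eq0 (negPf padic_p_neq0).
Qed.

End PadicNonunit.

(** * Kernels of presentations of finite modules *)

Section KernelModule.
Variables (E : nzRingType) (L A : lmodType E) (q : {linear L -> A}).

Definition ker_pred : {pred L} := fun v => q v == 0.

Fact ker_pred_closed : submod_closed ker_pred.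
Proof.
split=> [|a v w]; rewrite /in_mem /= /ker_pred ?linear0 //.
by move=> /eqP qv /eqP qw; rewrite linearP qv qw scaler0 addr0.
Qed.
HB.instance Definition _ := GRing.isSubmodClosed.Build E L ker_pred
  ker_pred_closed.

Record ker_module := KerModule { ker_val : L; _ : ker_val \in ker_pred }.
HB.instance Definition _ := [isSub for ker_val].
HB.instance Definition _ := [Choice of ker_module by <:].
HB.instance Definition _ := [SubChoice_isSubLmodule of ker_module by <:].

Lemma ker_short_exact : (forall a, exists v, q v = a) ->
  short_exact (val : {linear ker_module -> L}) q.
Proof.
move=> qsurj; split=> [|//|v]; first exact: val_inj.
split=> [qv|[m ->]]; last by apply/eqP; exact: (valP m).
have vK : v \in ker_pred by apply/eqP.
by exists (KerModule vK).
Qed.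

End KernelModule.

Section FiniteModules.
Variables (R : comNzRingType) (pi : uniformizer R) (gT : finGroupType).
Local Notation RG := (groupRing R gT).
Local Notation const := (gr_const gT).

(** By the pigeonhole principle pi^i a = pi^j a for some i < j <= |A|; as 1 - pi^(j-i) is a unit,
    pi^i a = 0. *)
Lemma finite_unif_torsion (A : finLmodType RG) (a : A) :
  const (unif pi ^+ #|A|) *: a = 0.
Proof.
pose f (k : 'I_#|A|.+1) : A := const (unif pi ^+ k) *: a.
have [i [j [ij fij]]] : exists i j : 'I_#|A|.+1, (i < j)%N /\ f i = f j.
  apply: contrapT => nf; have /leq_card : injective f.
    move=> i j fij; apply: val_inj; apply/eqP.
    case: ltngtP => // ij; case: nf; first by exists i, j.
    by exists j, i.
  by rewrite card_ord ltnn.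
have [s sE] := unit_1B pi (unif pi ^+ (j - i).-1).
have e : unif pi ^+ j = unif pi ^+ i * (unif pi * unif pi ^+ (j - i).-1).
  by rewrite -exprS prednK ?subn_gt0 // -exprD subnKC // ltnW.
have fi0 : f i = 0.
  have : const (1 - unif pi * unif pi ^+ (j - i).-1) *: f i = 0.
    rewrite /f scalerA -gr_constM mulrBl mul1r mulrC -e.
    have -> : const (unif pi ^+ i - unif pi ^+ j) = const (unif pi ^+ i) -
      const (unif pi ^+ j).
      by apply/(canRL (addrK _)); rewrite -gr_constD subrK.
    by rewrite scalerBl -/(f i) -/(f j) fij subrr.
  move=> /(congr1 (fun x => const s *: x)); rewrite scaler0 scalerA -gr_constM.
  by rewrite mulrC sE gr_const1 scale1r.
have iA : (i <= #|A|)%N by rewrite -ltnS.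
by rewrite -(subnK iA) exprD gr_constM -scalerA -/(f i) fi0 scaler0.
Qed.

Lemma restriction_linear (M L : lmodType RG) (i : {linear M -> L}) :
  linear (i : restriction M -> restriction L).
Proof. by move=> a v w; rewrite !restriction_scaleE linearP. Qed.

Lemma submodule_basis (A : finLmodType RG) (M L : lmodType RG)
    (i : {linear M -> L}) (q : {linear L -> A}) (J : finType) (y : J ->
      restriction L) :
  (forall a, unif pi * a = 0 -> a = 0) -> short_exact i q -> basis y ->
  exists x : J -> restriction M, basis x.
Proof.
move=> preg [iinj _ kerq] yb.
pose i' : {linear restriction M -> restriction L} := HB.pack
  (i : restriction M -> restriction L)
  (GRing.isLinear.Build R (restriction M) (restriction L) _ _
    (restriction_linear i)).
apply: (@basis_of_full_submodule _ pi _ _ i' J y #|A|) => // l.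
have /kerq [x xE] : q (const (unif pi ^+ #|A|) *: l) = 0.
  by rewrite linearZ /= finite_unif_torsion.
by exists x; rewrite restriction_scaleE xE.
Qed.

End FiniteModules.

(** * Transfer of cohomological triviality, and the equivalence *)

Section ShortExact.
Variables (R : comNzRingType) (gT : finGroupType).
Variables (M L A : lmodType (groupRing R gT)).
Variables (i : {linear M -> L}) (q : {linear L -> A}) (exact_iq : short_exact i
  q).

Lemma cohomologically_trivial_sub :
  cohomologically_trivial L -> cohomologically_trivial A ->
  cohomologically_trivial M.
Proof.
have [iinj qsurj kerq] := exact_iq; move=> vanL vanA S.
apply: (@tate_sub _ M L A i q (@subg_act _ _ M S) (@subg_act _ _ L S)
  (@subg_act _ _ A S)) => //.
- exact: subg_actM.
- exact: subg_actK.
- by move=> s m /=; rewrite linearZ.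
- by move=> s m /=; rewrite linearZ.
Qed.

Lemma cohomologically_trivial_quotient :
  cohomologically_trivial L -> cohomologically_trivial M ->
  cohomologically_trivial A.
Proof.
have [iinj qsurj kerq] := exact_iq; move=> vanL vanM S.
apply: (@tate_quotient _ M L A i q (@subg_act _ _ M S) (@subg_act _ _ L S)
  (@subg_act _ _ A S)) => //.
- exact: subg_actM.
- exact: subg_actK.
- by move=> s m /=; rewrite linearZ.
- by move=> s m /=; rewrite linearZ.
Qed.

End ShortExact.

Theorem corollary1p3 (p : nat) (p_prime : prime p)
    (gT : finGroupType) (G_pgroup : (p.-group [set: gT])%g)
    (Qp : padicField p) (K : fieldExtType Qp)
    (pi : uniformizer (ringOfIntegers K))
    (A : finLmodType (groupRing (ringOfIntegers K) gT)) :
  cohomologically_trivial A <->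
  (forall (M L : lmodType (groupRing (ringOfIntegers K) gT))
     (i : {linear M -> L}) (q : {linear L -> A}),
     short_exact i q -> free_of_finite_rank L -> rR pi M = rR pi L).
Proof.
have preg := unif_regular p_prime (pi := pi).
have pdvd := unif_dvd_p p_prime pi.
have rR_of_basis (V : lmodType (groupRing (ringOfIntegers K) gT)) n
    (y : gT * 'I_n -> restriction V) :
    basis y -> cohomologically_trivial V -> rR pi V = n.
  move=> yb vanV; apply: (rR_eq_of_norm p_prime G_pgroup pdvd yb).
  by apply: (norm_top_of_tate preg yb);
    [exact: (vanV _ (Negz 0)) | exact: (vanV _ (Posz 0))].
split=> [vanA M L i q ex_iq freeL | rRA].
  have [n [x xb]] := free_translates freeL.
  have vanL := translates_cohomologically_trivial xb.
  have [y yb] := submodule_basis preg ex_iq xb.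
  rewrite (rR_of_basis _ _ _ xb vanL); apply: rR_of_basis yb _.
  exact: cohomologically_trivial_sub ex_iq vanL vanA.
pose E := groupRing (ringOfIntegers K) gT.
(* For the converse one presentation suffices: the one with a free generator for each element of
   [A]. *)
pose n := #|A|; pose L : lmodType E := 'rV[E]_n.
pose f (u : L) : A := \sum_(k < n) u 0 k *: enum_val k.
have flin : linear f.
  move=> a u v; rewrite /f scaler_sumr -big_split; apply: eq_bigr => k _.
  by rewrite !mxE scalerDl scalerA.
pose q : {linear L -> A} := HB.pack f (GRing.isLinear.Build E L A _ f flin).
have qsurj a : exists u, q u = a.
  exists (delta_mx 0 (enum_rank a)); rewrite /= /f (bigD1 (enum_rank a)) //=.
  rewrite mxE !eqxx scale1r enum_rankK big1 ?addr0 // => k /negPf ka.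
  by rewrite mxE ka scale0r.
have ex_iq := ker_short_exact qsurj.
have freeL : free_of_finite_rank L by exists n, idfun; exists idfun.
have [m [x xb]] := free_translates freeL.
have vanL := translates_cohomologically_trivial xb.
apply: (cohomologically_trivial_quotient ex_iq) => //.
have [y yb] := submodule_basis preg ex_iq xb.
have rRM := rRA _ _ _ _ ex_iq freeL.
rewrite (rR_of_basis _ _ _ xb vanL) in rRM.
have [z zb] := group_ring_basis_of_rR p_prime G_pgroup pdvd yb rRM.
exact: translates_cohomologically_trivial zb.
Qed.
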